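(* There exists a universal constant $c>1$ such that for every sufficiently large $n>0$ the following holds. Let $\mathsf{RO}:\{0,1\}^n\to\{0,1\}^n$ be a random oracle. For any memory size $S$ with $n\leq S<2^{O(n^{1/4})}$ and any running time $T$ with $S\leq T<2^{O(n^{1/4})}$, there is an oracle function $f^{\mathsf{RO}}:\{0,1\}^{S}\to\{0,1\}^n$ such that: (1) $f^{\mathsf{RO}}$ can be computed in time $O(T\cdot n)$ using memory of size $O(S)$ by a RAM algorithm with oracle access to $\mathsf{RO}$; (2) for any randomized massively parallel computation $\mathcal{A}^{\mathsf{RO}}$ with $m<2^{O(n^{1/4})}$ machines, local memory of size $s\leq S/c$, and fewer than $q<2^{n/4}$ queries to $\mathsf{RO}$ per machine per round, $\mathcal{A}^{\mathsf{RO}}$ needs at least $\tilde{\Omega}(T)$ rounds to compute $f^{\mathsf{RO}}$, even in the average case (i.e., no such algorithm with fewer rounds computes $f^{\mathsf{RO}}$ correctly in the average case).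
   Context: Notation: $\tilde{\Omega}(T)=\Omega(T/\mathrm{polylog}(T))$. A random oracle $\mathsf{RO}:\{0,1\}^n\to\{0,1\}^n$ is a function drawn uniformly at random from all such functions; a query to it costs $O(n)$ time in the RAM model. Massively parallel computation (MPC) with a random oracle: there are $m$ machines, each with local memory of $s$ bits, a shared read-only random tape (arbitrarily long random string), and oracle access to $\mathsf{RO}$, drawn before the computation begins. The input $x\in\{0,1\}^N$ is split arbitrarily among the machines' local memories. Computation proceeds in synchronous rounds $k=0,1,2,\dots$. In round $k$ each machine $i$ runs a (polynomial-time) algorithm on its local memory $M_i^k$, the shared tape, and adaptive queries to $\mathsf{RO}$ (here at most $q$ queries per machine per round), and outputs a message $M_{i,j}^k$ for every machine $j$; the union $\bigcup_j M_{j,i}^k$ of messages received by machine $i$ must have size at most $s$ and forms its memory at round $k+1$. An $R$-round computation terminates at the end of round $R$ and its output is the union of the outputs of all machines. It computes a function $f$ in the average case if, for an input $x$ drawn uniformly at random and arbitrarily distributed among the machines, the output equals $f(x)$ with probability at least $1/3$ over the input, the randomness of the computation, and the random oracle. *)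

(* Defs.v *)
From mathcomp Require Import all_boot all_order all_algebra.
From mathcomp Require Import reals exp.

Set Implicit Arguments.
Unset Strict Implicit.
Unset Printing Implicit Defensive.

Notation bits n := (n.-tuple bool).
Notation oracle n := {ffun bits n -> bits n}.

(* Random access machine with an oracle. The machine has a bit-addressable
   memory and a fixed number r of registers holding machine words. A program is
   a finite object that mentions neither n, S nor T: these are passed in
   registers. *)

Inductive instr (r : nat) : Type :=
| IConst of 'I_r & nat
| IMove of 'I_r & 'I_r
| IAdd of 'I_r & 'I_r & 'I_r
| ISub of 'I_r & 'I_r & 'I_r
| IMul of 'I_r & 'I_r & 'I_r
| IDiv of 'I_r & 'I_r & 'I_r
| ILoad of 'I_r & 'I_r     (* r_d := mem[r_a] *)
| IStore of 'I_r & 'I_r    (* mem[r_a] := (r_b != 0) *)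
| IJz of 'I_r & nat
| IAsk of 'I_r & 'I_r      (* mem[r_b ..+ n] := RO (mem[r_a ..+ n]) *)
| IHalt.
Arguments IHalt {r}.

Record ram_prog := RamProg { ram_nreg : nat; ram_code : seq (instr ram_nreg) }.

Record config (r : nat) := Config {
  cfg_pc : nat;
  cfg_regs : 'I_r -> nat;
  cfg_mem : nat -> bool
}.

Definition upd (I : eqType) (V : Type) (g : I -> V) (i : I) (v : V) : I -> V :=
  fun j => if j == i then v else g j.

Definition mem_block (n : nat) (g : nat -> bool) (a : nat) : bits n :=
  [tuple g (a + i) | i < n].

Definition write_block (n : nat) (g : nat -> bool) (a : nat) (y : bits n) :
    nat -> bool :=
  fun j => if a <= j < a + n then nth false y (j - a) else g j.

(* [None]: the program counter is out of range, the machine halts, a value does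
   not fit in a W-bit word, or an address is not below M. *)
Definition ram_step (r n W M : nat) (RO : oracle n) (code : seq (instr r))
    (c : config r) : option (config r) :=
  let: Config l g h := c in
  let set d v := if v < 2 ^ W then Some (Config l.+1 (upd g d v) h) else None in
  match nth IHalt code l with
  | IConst d k => set d k
  | IMove d a => set d (g a)
  | IAdd d a b => set d (g a + g b)
  | ISub d a b => set d (g a - g b)
  | IMul d a b => set d (g a * g b)
  | IDiv d a b => set d (g a %/ g b)
  | ILoad d a => if g a < M then set d (nat_of_bool (h (g a))) else None
  | IStore a b =>
      if g a < M then Some (Config l.+1 g (upd h (g a) (g b != 0))) else None
  | IJz a l' => Some (Config (if g a == 0 then l' else l.+1) g h)
  | IAsk a b =>
      if (g a + n <= M) && (g b + n <= M)
      then Some (Config l.+1 g (write_block h (g b) (RO (mem_block n h (g a)))))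
      else None
  | IHalt => None
  end.

Definition instr_cost (r n : nat) (i : instr r) : nat :=
  if i is IAsk _ _ then n else 1.

Inductive ram_run (r n W M : nat) (RO : oracle n) (code : seq (instr r)) :
    nat -> config r -> config r -> Prop :=
| RunHalt c of cfg_pc c < size code & nth IHalt code (cfg_pc c) = IHalt :
    ram_run W M RO code 1 c c
| RunStep c c' c'' t of ram_step W M RO code c = Some c'
    & ram_run W M RO code t c' c'' :
    ram_run W M RO code (instr_cost n (nth IHalt code (cfg_pc c)) + t) c c''.

(* Initially, registers 0, 1, 2 hold n, S, T and memory cells 0, ..., S-1 hold
   the input. *)
Definition ram_init (r n S T : nat) (x : bits S) : config r :=
  Config 0 (fun i : 'I_r => nth 0 [:: n; S; T] i) (fun a => nth false x a).

(* The output is read in memory cells 0, ..., n-1. The space, in bits, accounts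
   for the addressable memory (input included) and for the registers. *)
Definition ram_computes (P : ram_prog) (n S T W space time : nat)
    (f : oracle n -> bits S -> bits n) : Prop :=
  exists2 M : nat, M + ram_nreg P * W <= space &
  forall (RO : oracle n) (x : bits S), exists (t : nat) (c : config _),
    [/\ t <= time,
        ram_run W M RO (ram_code P) t (ram_init (ram_nreg P) n T x) c
      & mem_block n (cfg_mem c) 0 = f RO x].

(* Computations with adaptive oracle queries and unrestricted processing between
   queries. *)

Inductive qalg (n : nat) (A : Type) : Type :=
| QRet of A
| QAsk of bits n & (bits n -> qalg n A).

Fixpoint qrun (n : nat) (A : Type) (RO : oracle n) (t : qalg n A) : A :=
  match t with
  | QRet a => a
  | QAsk u k => qrun RO (k (RO u))
  end.

Fixpoint qcount (n : nat) (A : Type) (RO : oracle n) (t : qalg n A) : nat :=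
  match t with
  | QRet _ => 0
  | QAsk u k => (qcount RO (k (RO u))).+1
  end.

(* [A k i w z] is what machine i does in round k on local memory w and shared
   tape z: it returns its messages to all machines, and its output (which is
   looked at in the last round only). *)
Definition mpc (n m tl : nat) : Type :=
  nat -> 'I_m -> seq bool -> bits tl -> qalg n (('I_m -> seq bool) * seq bool).

(* The input bit number j is initially given to machine p j. A local memory is a
   bare bit string: received messages are concatenated by increasing index of
   the sender, and sender identities and message boundaries are not available
   unless they are encoded in the messages. *)
Fixpoint mpc_mem (n m tl S : nat) (A : mpc n m tl) (p : 'I_S -> 'I_m)
    (RO : oracle n) (z : bits tl) (x : bits S) (k : nat) : 'I_m -> seq bool :=
  match k with
  | 0 => fun i => [seq tnth x j | j <- enum 'I_S & p j == i]
  | k'.+1 => fun i =>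
      flatten [seq (qrun RO (A k' j (mpc_mem A p RO z x k' j) z)).1 i
              | j <- enum 'I_m]
  end.

(* A rd-round computation executes the rounds 0, ..., rd. *)
Definition mpc_output (n m tl S : nat) (A : mpc n m tl) (p : 'I_S -> 'I_m)
    (rd : nat) (RO : oracle n) (z : bits tl) (x : bits S) : seq bool :=
  flatten [seq (qrun RO (A rd i (mpc_mem A p RO z x rd i) z)).2
          | i <- enum 'I_m].

Definition mpc_within (n m tl S : nat) (A : mpc n m tl) (p : 'I_S -> 'I_m)
    (rd s q : nat) : Prop :=
  forall (RO : oracle n) (z : bits tl) (x : bits S) (k : nat) (i : 'I_m),
    k <= rd ->
    size (mpc_mem A p RO z x k i) <= s /\
    qcount RO (A k i (mpc_mem A p RO z x k i) z) <= q.

Local Open Scope ring_scope.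

Definition mpc_success (R : realType) (n m tl S : nat) (A : mpc n m tl)
    (p : 'I_S -> 'I_m) (rd : nat) (f : oracle n -> bits S -> bits n) : R :=
  #|[pred w : oracle n * bits tl * bits S |
      mpc_output A p rd w.1.1 w.1.2 w.2 == f w.1.1 w.2 :> seq bool]|%:R
  / #|{: oracle n * bits tl * bits S}|%:R.

Definition computes_on_average (R : realType) (n m tl S : nat)
    (A : mpc n m tl) (p : 'I_S -> 'I_m) (rd : nat)
    (f : oracle n -> bits S -> bits n) : Prop :=
  1 / 3 <= mpc_success R A p rd f.

Definition exp_quarter (R : realType) (K : R) (n : nat) : R :=
  2 `^ (K * n%:R `^ (1 / 4)).

(* Main.v *)
Require Import Defs.
From mathcomp Require Import all_boot all_order all_algebra.
From mathcomp Require Import reals exp.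
From mathcomp Require Import boolp zify lra.

Set Implicit Arguments.
Unset Strict Implicit.
Unset Printing Implicit Defensive.

(** Write h for the integer part of sqrt n / 12. The hard function iterates
    st := RO (ins x st) T times from the zero state, where [ins x st] replaces
    each of the first 8h slots of 12h bits of st by a piece of x which is selected
    by the content of the slot (n - 96 h^2, about n / 3, bits of st are kept). The
    arguments N_0, N_1, ... of RO are the nodes of the line, and at least T - 1
    rounds are needed because, with high probability, no node N_i with i > k is
    queried in the rounds 0, ..., k.

    Assume this for the earlier rounds, so that the memories at the beginning of
    round k do not depend on RO (N_i) for i >= k. Re-drawing RO (N_i) shows that a
    machine reaches N_(i+1) in round k only if, for a fraction larger than
    2^(1 - 2h) of the possible answers a to N_i, it asks [ins x a]. For a fixed
    memory and a fixed oracle this concerns few inputs x: a t-th moment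
    computation, with t proportional to the number of pieces per slot, bounds their
    proportion by 2^(- Omega(S)), since all but a fraction 2^(- 2h) of the answers
    a select at least 7h pieces that are not selected by t - 1 given answers, hence
    84 h^2 > n / 2 new input bits, while q < 2^(n/4) queries allow few guesses. A
    union bound over the memories of at most S / c bits concludes. As h is of order
    sqrt n, the bound 2^(- 2h) survives a union bound over 2^(O(n^(1/4)))
    machines and rounds. *)

(** * Counting by resampling *)

Lemma card_fibers (A B : finType) (E : pred (A * B)) :
  #|[pred w | E w]| = \sum_a #|[pred b | E (a, b)]|.
Proof.
rewrite -sum1_card (eq_bigl (fun w => E (w.1, w.2))); last by case.
rewrite -(pair_big_dep xpredT (fun a b => E (a, b)) (fun _ _ => 1)) /=.
by apply: eq_bigr => a _; rewrite sum1_card.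
Qed.

Lemma leq_card_fibers (A B : finType) (E : pred (A * B)) (k l : nat) :
  (forall a, #|[pred b | E (a, b)]| * k <= l) ->
  #|[pred w | E w]| * k <= l * #|A|.
Proof.
move=> bound; rewrite card_fibers big_distrl /= mulnC -sum_nat_const.
exact: leq_sum.
Qed.

(* The map (t, v) |-> (set t v, get t) is injective: re-drawing the value v of t
   and remembering the old one loses nothing. *)
Lemma card_resample (T V : finType) (get : T -> V) (set : T -> V -> T)
    (C : pred T) (B : T -> pred V) (k : nat) :
  (forall t v, C t ->
     [/\ C (set t v), get (set t v) = v, set (set t v) (get t) = t
       & B (set t v) =1 B t]) ->
  (forall t, C t -> #|B t| <= k) ->
  #|[pred t | C t && B t (get t)]| * #|V| <= k * #|C|.
Proof.
move=> setP leBk.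
pose D := [pred tv : T * V | C tv.1 && B tv.1 (get tv.1)].
pose phi (tv : T * V) := (set tv.1 tv.2, get tv.1).
have -> : #|[pred t | C t && B t (get t)]| * #|V| = #|D|.
  rewrite (@card_fibers _ _ D) -[LHS]sum_nat_const [LHS]big_mkcond /=.
  apply: eq_bigr => t _; rewrite unfold_in.
  by case: ifP => /= CBt; [apply/esym/eq_card|rewrite eq_card0] => // v;
     rewrite !inE CBt.
have phiI : {in D &, injective phi}.
  move=> [t v] [t' v'] /andP[/= Ct _] /andP[/= Ct' _] [e1 e2].
  have [_ gv sg _] := setP t v Ct; have [_ gv' sg' _] := setP t' v' Ct'.
  by congr (_, _); [rewrite -sg -sg' e1 e2 | rewrite -gv -gv' e1].
rewrite -(card_in_image phiI).
pose E := [pred tw : T * V | C tw.1 && B tw.1 tw.2].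
apply: (@leq_trans #|E|).
  apply: subset_leq_card; apply/subsetP => _ /imageP[[t v] /andP[/= Ct Bt] ->].
  by have [Cs _ _ eB] := setP t v Ct; rewrite inE /= Cs eB.
rewrite (@card_fibers _ _ E) mulnC -sum_nat_const [leqRHS]big_mkcond /=.
apply: leq_sum => t _; case: ifP => [Ct|nCt]; last first.
  by rewrite eq_card0 // => v; rewrite !inE; move: nCt; rewrite unfold_in => ->.
by apply: leq_trans (leBk t Ct); apply: subset_leq_card; apply/subsetP => v;
   rewrite !inE => /andP[].
Qed.

(** The coordinates in [s] are re-drawn one after the other; each step preserves [C] and the
    conditions on the other coordinates, so the proportions [k / #|V|] multiply. *)
Lemma card_resample_seq (T V : finType) (I : eqType) (get : I -> T -> V)
    (set : I -> T -> V -> T) (B : I -> pred V) (k : nat) (C : pred T)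
    (s : seq I) :
  uniq s ->
  {in s, forall i t v, get i (set i t v) = v} ->
  {in s, forall i t v, set i (set i t v) (get i t) = t} ->
  {in s &, forall i j, i != j -> forall t v, get i (set j t v) = get i t} ->
  {in s, forall i t v, C t -> C (set i t v)} ->
  {in s, forall i, #|B i| <= k} ->
  #|[pred t | C t && all (fun i => B i (get i t)) s]| * #|V| ^ size s
    <= k ^ size s * #|C|.
Proof.
elim: s => [|i s IHs] /= us getK setK gets Cset Bk.
  rewrite muln1 mul1n; apply: subset_leq_card.
  by apply/subsetP => t; rewrite inE => /andP[].
have /andP[nis uniqs] := us.
have IH : #|[pred t | C t && all (fun i => B i (get i t)) s]| * #|V| ^ size s
    <= k ^ size s * #|C|.
  apply: IHs => //.
  - by move=> a ai; apply: getK; rewrite inE ai orbT.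
  - by move=> a ai; apply: setK; rewrite inE ai orbT.
  - by move=> a b ai bi; apply: gets; rewrite inE ?ai ?bi orbT.
  - by move=> a ai; apply: Cset; rewrite inE ai orbT.
  - by move=> a ai; apply: Bk; rewrite inE ai orbT.
pose C' := [pred t | C t && all (fun i => B i (get i t)) s].
have := @card_resample T V (get i) (set i) C' (fun _ => B i) k.
case/(_ _ _)/Wrap => [t v /andP[Ct alls]|t _|step].
- split=> //=; [|by rewrite getK ?mem_head|by rewrite setK ?mem_head].
  rewrite Cset ?mem_head //=.
  apply/allP => j js; rewrite gets ?inE ?eqxx ?js ?orbT //.
    exact: (allP alls).
  by apply: contraNneq nis => <-.
- by apply: Bk; rewrite mem_head.
rewrite !expnS mulnA.
have -> : #|[pred t | [&& C t, B i (get i t) & all (fun i => B i (get i t)) s]]|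
    = #|[pred t | C' t && B i (get i t)]|.
  by apply: eq_card => t; rewrite !inE -andbA [X in _ && X]andbC.
apply: leq_trans (leq_mul step (leqnn _)) _.
by rewrite -!mulnA leq_mul2l IH orbT.
Qed.

(** * Bit strings *)

Definition get_block (N b : nat) (o : nat) (x : bits N) : bits b :=
  mem_block b (nth false x) o.
Definition set_block (N b : nat) (o : nat) (x : bits N) (w : bits b) : bits N :=
  [tuple write_block (nth false x) o w i | i < N].

Lemma nth_mktuple_bits (n : nat) (F : nat -> bool) (i : nat) :
  nth false [tuple F i | i < n] i = (i < n) && F i.
Proof.
case: ltnP => [lt_in|le_ni]; last by rewrite nth_default ?size_tuple.
by rewrite andTb -[i]/(nat_of_ord (Ordinal lt_in)) -tnth_nth tnth_mktuple.
Qed.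

Lemma eq_bits (n : nat) (x y : bits n) :
  (forall i, i < n -> nth false x i = nth false y i) -> x = y.
Proof.
move=> exy; apply: eq_from_tnth => i.
by rewrite !(tnth_nth false) exy.
Qed.

Lemma nth_bits_default (n : nat) (x : bits n) (i : nat) :
  n <= i -> nth false x i = false.
Proof. by move=> le_ni; rewrite nth_default ?size_tuple. Qed.

Lemma nth_mem_block (n : nat) (g : nat -> bool) (a i : nat) :
  nth false (mem_block n g a) i = (i < n) && g (a + i).
Proof. exact: (nth_mktuple_bits n (fun i => g (a + i))). Qed.

Lemma nth_set_block (N b o : nat) (x : bits N) (w : bits b) (i : nat) :
  nth false (set_block o x w) i =
    (i < N) && (if o <= i < o + b then nth false w (i - o) else nth false x i).
Proof. exact: nth_mktuple_bits. Qed.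

Section Blocks.
Variables (N b : nat).
Implicit Types (x : bits N) (w : bits b) (o : nat).

Lemma get_set_block o x w : o + b <= N -> get_block b o (set_block o x w) = w.
Proof.
move=> le_obN; apply: eq_bits => i lt_ib.
by rewrite nth_mem_block nth_set_block lt_ib addKn ifT; [|lia]; case: ltnP; lia.
Qed.

Lemma set_set_block o x w : set_block o (set_block o x w) (get_block b o x) = x.
Proof.
apply: eq_bits => i lt_iN; rewrite nth_set_block lt_iN nth_mem_block.
rewrite nth_set_block lt_iN /=.
case: ifP => [/andP[le_oi lt_iob]|->//].
by rewrite subnKC // andb_idl // => _; lia.
Qed.

Lemma get_set_block_disjoint (b' o o' : nat) x w :
  (o' + b' <= o) || (o + b <= o') ->
  get_block b' o' (set_block o x w) = get_block b' o' x.
Proof.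
move=> dis; apply: eq_bits => i lt_ib.
rewrite !nth_mem_block nth_set_block lt_ib /=.
rewrite ifF; last by apply/negbTE; lia.
by case: ltnP => //= ?; rewrite nth_bits_default.
Qed.

End Blocks.

Lemma card_bits (n : nat) : #|{: bits n}| = 2 ^ n.
Proof. by rewrite card_tuple card_bool. Qed.

(** Horner form with doubling by addition, most significant bit first, as the machine code decodes a
    slot. *)
Definition bin_val (s : seq bool) : nat := foldl (fun p (c : bool) => p + p + c) 0 s.

Lemma bin_val_rcons s c : bin_val (rcons s c) = bin_val s + bin_val s + c.
Proof. by rewrite /bin_val -cats1 foldl_cat. Qed.

Lemma bin_val_inj (n : nat) : injective (fun w : bits n => bin_val w).
Proof.
suff inj (s t : seq bool) : size s = size t -> bin_val s = bin_val t -> s = t.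
  by move=> w w' e; apply/val_inj/inj => //; rewrite !size_tuple.
elim/last_ind: s t => [|s c IHs] t; first by case: t.
case/lastP: t => [|t c']; rewrite ?size_rcons // => -[est].
rewrite !bin_val_rcons => e.
have ec : c = c' by case: c c' e => -[]; lia.
by rewrite ec; congr rcons; apply: IHs => //; move: e; rewrite ec; lia.
Qed.

Lemma bin_val_lt (s : seq bool) : bin_val s < 2 ^ size s.
Proof.
elim/last_ind: s => // s c IHs.
by rewrite bin_val_rcons size_rcons expnS; case: c; lia.
Qed.

(** A word with a given residue is determined by its quotient, which takes at most [2 ^ b %/ v + 1]
    values; [v <= 2 ^ b] absorbs the extra one in the factor 2. *)
Lemma card_bin_val_mod (b v o : nat) : v <= 2 ^ b ->
  #|[pred w : bits b | bin_val w %% v == o]| * v <= 2 * 2 ^ b.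
Proof.
case: v => [|v] lev; first by rewrite muln0.
set P := [pred w : bits b | _].
have le_q : #|P| <= 2 ^ b %/ v.+1 + 1.
  pose phi (w : bits b) : 'I_(2 ^ b %/ v.+1).+1 := inord (bin_val w %/ v.+1).
  have phiE w : phi w = bin_val w %/ v.+1 :> nat.
    rewrite inordK // ltnS leq_div2r // -[b in 2 ^ b](size_tuple w).
    exact/ltnW/bin_val_lt.
  rewrite addn1 -[leqRHS]card_ord -(@card_in_imset _ _ phi P) ?max_card //.
  move=> w w'; rewrite !inE => /eqP e /eqP e' /(congr1 val) /=; rewrite !phiE.
  by move=> ed; apply: bin_val_inj; rewrite (divn_eq (bin_val w) v.+1) ed e -e'
    -divn_eq.
apply: leq_trans (leq_mul le_q (leqnn _)) _.
rewrite mulnDl mul1n mul2n -addnn leq_add //; exact: leq_divM.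
Qed.

(** Union bound over [s]; proportions are cross-multiplied to stay in [nat]. *)
Lemma leq_card_mem_seq (T : finType) (V : eqType) (C : pred T) (F : T -> V)
    (k l : nat) (s : seq V) :
  (forall y, #|[pred t | C t && (F t == y)]| * k <= l) ->
  #|[pred t | C t && (F t \in s)]| * k <= size s * l.
Proof.
move=> bound; elim: s => [|y s IHs] /=.
  by rewrite eq_card0 // => t; rewrite !inE andbF.
rewrite mulSn; apply: leq_trans (leq_add (bound y) IHs).
rewrite -mulnDl leq_mul2r; apply/orP; right.
rewrite -cardUI; apply: leq_trans (leq_addr _ _); apply: subset_leq_card.
by apply/subsetP => t; rewrite !inE -andb_orr.
Qed.

(** * The hard function *)

(* A state is cut into g slots of b bits, followed by a tail. The input is cut
   into v rows of g * b bits. The content of the slot at offset o, reduced modulo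
   v, designates a row of the input, whose part at the same offset replaces the
   slot. Only the first k slots are replaced by [fill]. *)
Definition slot_row (n b v o : nat) (st : bits n) : nat :=
  bin_val (get_block b o st) %% v.

Definition fill (n S b g v : nat) (x : bits S) (k : nat) (st : bits n) : bits n :=
  [tuple if i < k * b
         then nth false x (slot_row b v (i %/ b * b) st * (g * b) + i)
         else nth false st i | i < n].

Definition line_state (n S b g v : nat) (RO : oracle n) (x : bits S) (i : nat) :
    bits n :=
  iter i (fun st => RO (fill b g v x g st)) [tuple false | _ < n].

Section Fill.
Variables (n S b g v : nat).
Hypotheses (b_gt0 : 0 < b) (v_gt0 : 0 < v).
Hypotheses (le_gb_n : g * b <= n) (le_vgb_S : v * (g * b) <= S).
Implicit Types (x : bits S) (a : bits n) (l : seq (bits n)).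

Local Notation row k := (@slot_row n b v (k * b)).
Local Notation cell k a := (row k a * (g * b) + k * b).
Local Notation ins x a := (fill b g v x g a).

Lemma slot_row_lt o a : slot_row b v o a < v.
Proof. by rewrite ltn_mod. Qed.

Lemma nth_fill x k a i :
  nth false (fill b g v x k a) i = (i < n) &&
    (if i < k * b then nth false x (slot_row b v (i %/ b * b) a * (g * b) + i)
     else nth false a i).
Proof.
exact: (nth_mktuple_bits n (fun i => if i < k * b
  then nth false x (slot_row b v (i %/ b * b) a * (g * b) + i)
  else nth false a i)).
Qed.

Lemma cell_le_S k a : k < g -> cell k a + b <= S.
Proof.
move=> lt_kg; apply: leq_trans le_vgb_S; have := slot_row_lt (k * b) a.
by nia.
Qed.

Lemma get_block_ins x a k : k < g ->
  get_block b (k * b) (ins x a) = get_block b (cell k a) x.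
Proof.
move=> lt_kg; apply: eq_bits => i lt_ib.
have lt_kig : k * b + i < g * b by nia.
rewrite !nth_mem_block nth_fill lt_ib (leq_trans lt_kig) //= lt_kig.
by rewrite divnMDl // (divn_small lt_ib) addn0 addnA.
Qed.

Lemma get_tail_ins x a :
  get_block (n - g * b) (g * b) (ins x a) = get_block (n - g * b) (g * b) a.
Proof.
apply: eq_bits => i lt_i; rewrite !nth_mem_block nth_fill lt_i /=.
by rewrite ifF; [case: ltnP => // ?; rewrite nth_bits_default|lia].
Qed.

(** The tail of [n - g * b] bits survives the filling, so each target in [Q] leaves only the slots
    of [a] free. *)
Lemma card_ins_mem x (Q : seq (bits n)) :
  #|[pred a | ins x a \in Q]| <= size Q * 2 ^ (g * b).
Proof.
have := @leq_card_mem_seq _ _ xpredT (fun a => ins x a) (2 ^ (n - g * b)) (2 ^ n) Q.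
rewrite -[in 2 ^ n](subnKC le_gb_n) expnD mulnA leq_pmul2r ?expn_gt0 //.
apply => y; rewrite /= -expnD subnKC //.
have := @card_resample (bits n) (bits (n - g * b))
  (get_block _ (g * b)) (set_block (g * b)) xpredT
  (fun _ => pred1 (get_block _ (g * b) y)) 1.
case/(_ _ _)/Wrap => [t w _|t _|].
- by split; rewrite ?set_set_block // get_set_block // subnKC.
- by rewrite card1.
rewrite mul1n card_bits => bound.
have <- : #|(xpredT : pred (bits n))| = 2 ^ n.
  by rewrite -card_bits; apply: eq_card.
apply: leq_trans bound; rewrite leq_mul2r; apply/orP; right.
apply: subset_leq_card; apply/subsetP => a; rewrite !inE => /eqP <-.
by rewrite get_tail_ins eqxx.
Qed.

Lemma ins_set_cell x a a' k w : k < g -> row k a != row k a' ->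
  ins (set_block (cell k a) x (w : bits b)) a' = ins x a'.
Proof.
move=> lt_kg neq_row; apply: eq_bits => i lt_in; rewrite !nth_fill lt_in /=.
case: ifP => // lt_ig; rewrite nth_set_block ifF.
  by case: ltnP => // ?; rewrite nth_bits_default.
apply/negbTE/negP => /andP[le1 lt2].
have lt_iG : i < g * b by [].
(* A position inside a cell determines the row and the slot, by division by [g * b] and then by
   [b]. *)
have eq_row : row k a = slot_row b v (i %/ b * b) a'.
  by apply/eqP; rewrite eqn_leq; apply/andP; split; nia.
have eq_k : i %/ b = k.
  apply/eqP; rewrite eqn_leq -ltnS ltn_divLR // leq_divRL //.
  by rewrite eq_row in le1 lt2; apply/andP; split; lia.
by move: neq_row; rewrite eq_row eq_k eqxx.
Qed.

(** In these slots [a] reads input cells that no element of [l] reads, hence bits still uniform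
    given the hits of [l]. *)
Definition new_slots l a : seq nat :=
  [seq k <- iota 0 g | row k a \notin [seq row k a' | a' <- l]].

Variables (L : bits n -> seq (bits n)) (q : nat).
Hypothesis size_L : forall a, size (L a) <= q.

(** [L a] stands for the queries made by a machine with a fixed memory once the current node is
    answered by [a]; it must not depend on [x]. *)
Definition hits l : pred (bits S) := fun x => all (fun a => ins x a \in L a) l.

(** For each of the at most [q] targets [y] in [L a], the equation [ins x a = y] prescribes [b] bits
    of [x] per new slot, in cells that can be re-drawn without affecting [hits l x]. *)
Lemma card_hits_cons D l a : D <= size (new_slots l a) ->
  #|[pred x | hits (a :: l) x]| * 2 ^ (D * b) <= q * #|[pred x | hits l x]|.
Proof.
move=> le_D; set s := new_slots l a in le_D.
have s_lt k : k \in s -> k < g by rewrite mem_filter mem_iota => /andP[].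
have := @leq_card_mem_seq _ _ [pred x | hits l x] (fun x => ins x a)
  (2 ^ (D * b)) #|[pred x | hits l x]| (L a).
case/(_ _)/Wrap => [y|bound]; last first.
  apply: leq_trans (leq_trans bound _); last by rewrite leq_mul2r size_L orbT.
  rewrite leq_mul2r; apply/orP; right; apply: subset_leq_card.
  by apply/subsetP => x; rewrite !inE andbC.
have := @card_resample_seq (bits S) (bits b) nat
  (fun k => get_block b (cell k a)) (fun k => set_block (cell k a))
  (fun k => pred1 (get_block b (k * b) y)) 1 [pred x | hits l x] s.
case/(_ _ _ _ _ _ _)/Wrap.
- by rewrite filter_uniq // iota_uniq.
- by move=> k /s_lt lt_kg x w; rewrite get_set_block // cell_le_S.
- by move=> k _ x w; rewrite set_set_block.
- move=> i j /s_lt lt_i /s_lt lt_j neq_ij x w; rewrite get_set_block_disjoint //.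
  have [lt_ij|lt_ji|] := ltngtP i j; last by move/eqP: neq_ij.
    have [le_r|lt_r] := leqP (row i a) (row j a); apply/orP; [left|right]; nia.
  have [le_r|lt_r] := leqP (row j a) (row i a); apply/orP; [right|left]; nia.
- move=> k ks x w; rewrite !inE => /allP hx; apply/allP => a' la'.
  rewrite ins_set_cell ?s_lt ?hx //.
  move: ks; rewrite mem_filter => /andP[+ _]; apply: contra => /eqP ->.
  exact: map_f.
- by move=> k _; rewrite card1.
rewrite exp1n mul1n card_bits -expnM => bound.
apply: leq_trans bound; apply: leq_mul.
  apply: subset_leq_card; apply/subsetP => x; rewrite !inE => /andP[-> /eqP <-].
  by apply/allP => k /s_lt lt_kg /=; rewrite get_block_ins // eqxx.
by rewrite leq_exp2l // mulnC leq_mul2l le_D orbT.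
Qed.

(* The number of pairs (a, x) with x in Xb hit by l and by a, counted in two
   ways. *)
Lemma card_hits_moment (Xb : pred (bits S)) (gam D t : nat) :
  (forall x, Xb x -> gam + gam <= #|[pred a | ins x a \in L a]|) ->
  (forall l, size l < t -> #|[pred a | size (new_slots l a) < D]| <= gam) ->
  gam ^ t * #|Xb| * 2 ^ (D * b * t) <= (2 ^ n * q) ^ t * 2 ^ S.
Proof.
move=> Xb_hits bad_gam.
(* Induction on the number [r] of answers still to be drawn, [l] being those already hit. *)
suff main r l : r + size l <= t ->
    gam ^ r * #|[pred x | Xb x && hits l x]| * 2 ^ (D * b * r)
      <= (2 ^ n * q) ^ r * #|[pred x | hits l x]|.
  have := main t [::]; rewrite addn0 => /(_ (leqnn _)).
  rewrite -(card_bits S); set A := #|_|; set A' := #|Xb|.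
  have -> : A = A' by apply: eq_card => x; rewrite !inE andbT.
  by have -> : #|[pred x | hits [::] x]| = #|{: bits S}| by apply: eq_card.
elim: r l => [|r IHr] l le_t; first by
  rewrite !expn0 muln0 muln1 !mul1n; apply: subset_leq_card;
  apply/subsetP => x; rewrite !inE => /andP[].
pose good := [pred a | D <= size (new_slots l a)].
(* At least [2 * gam] answers hit [x] and at most [gam] answers lack new slots, so [gam] good ones
   remain. *)
have two_ways : gam * #|[pred x | Xb x && hits l x]| <=
    \sum_(a | good a) #|[pred x | Xb x && hits (a :: l) x]|.
  rewrite mulnC -sum_nat_const.
  under [leqRHS]eq_bigr => a _ do rewrite -sum1_card big_mkcond /=.
  rewrite exchange_big /= [leqLHS]big_mkcond /=; apply: leq_sum => x _.
  case: ifP => // /andP[Xbx hlx].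
  rewrite -big_mkcondr /= sum1_card.
  have le1 := Xb_hits x Xbx; rewrite -(cardID good) in le1.
  have le2 := bad_gam l ltac:(lia).
  rewrite -(leq_add2r gam); apply: leq_trans le1 _; apply: leq_add.
    by apply: subset_leq_card; apply/subsetP => a /andP[ga ha];
      rewrite unfold_in /= !inE Xbx hlx andbT; apply/andP.
  apply: leq_trans le2; apply: subset_leq_card.
  by apply/subsetP => a; rewrite !inE -ltnNge => /andP[].
rewrite !expnS mulnS expnD.
have -> : gam * gam ^ r * #|[pred x | Xb x && hits l x]|
    * (2 ^ (D * b) * 2 ^ (D * b * r)) =
    (gam * #|[pred x | Xb x && hits l x]|) *
      (gam ^ r * (2 ^ (D * b) * 2 ^ (D * b * r))) by lia.
apply: leq_trans (leq_mul two_ways (leqnn _)) _.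
rewrite big_distrl /=.
apply: (@leq_trans (\sum_(a : bits n)
  ((2 ^ n * q) ^ r * (q * #|[pred x | hits l x]|)))); last first.
  by rewrite sum_nat_const card_bits; lia.
rewrite [leqLHS]big_mkcond; apply: leq_sum => a _; case: ifP => // good_a.
have le1 := IHr (a :: l) ltac:(by rewrite /= addnS).
have le2 := card_hits_cons good_a.
apply: (@leq_trans ((2 ^ n * q) ^ r * (#|[pred x | hits (a :: l) x]| * 2 ^ (D * b)))).
  rewrite [X in _ <= X]mulnA.
  apply: leq_trans (leq_mul le1 (leqnn (2 ^ (D * b)))).
  by move: #|_| => A; lia.
by rewrite leq_mul2l le2 orbT.
Qed.

End Fill.

Lemma card_slot_row_mem (b v e : nat) (s : seq nat) :
  v <= 2 ^ b -> size s * 2 ^ e.+1 <= v -> 0 < v ->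
  #|[pred w : bits b | bin_val w %% v \in s]| * 2 ^ e <= 2 ^ b.
Proof.
move=> le_v le_s v_gt0.
have := @leq_card_mem_seq _ _ xpredT (fun w : bits b => bin_val w %% v) v
  (2 * 2 ^ b) s (fun o => card_bin_val_mod o le_v).
rewrite /= => bound.
rewrite -(leq_pmul2r v_gt0) mulnAC.
apply: leq_trans (leq_mul bound (leqnn _)) _.
apply: leq_trans (_ : (size s * 2 ^ e.+1) * 2 ^ b <= _); last first.
  by rewrite mulnC leq_mul2l le_s orbT.
by rewrite expnS; lia.
Qed.

Section FewNew.
Variables (n b g v : nat) (l : seq (bits n)).
Hypotheses (b_ge : 10 <= b) (v_gt0 : 0 < v) (le_gb_n : g * b <= n).
Hypotheses (le_v : v <= 2 ^ b) (le_l : size l * 2 ^ 11 <= v).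

Let old (a : bits n) : {set 'I_g} :=
  [set k : 'I_g | slot_row b v (k * b) a \in
     [seq slot_row b v (k * b) a' | a' <- l]].

Let size_new_slots a : size (new_slots b g v l a) = g - #|old a|.
Proof.
rewrite size_filter.
set P := fun k => slot_row b v (k * b) a \in [seq slot_row b v (k * b) a' | a' <- l].
have -> : #|old a| = count P (iota 0 g).
  rewrite -val_enum_ord count_map cardE size_filter enumT.
  by apply: eq_count => k; rewrite /= !inE.
by rewrite -[X in X - _](size_iota 0 g) -(count_predC P) addKn.
Qed.

(** Slots are disjoint blocks of [a], hence independent, and each repeats a row selected by [l] with
    proportion at most [1 / 2 ^ 10]. *)
Let card_old_sup (A : {set 'I_g}) :
  #|[pred a : bits n | A \subset old a]| * 2 ^ (10 * #|A|) <= 2 ^ n.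
Proof.
pose B (k : 'I_g) : pred (bits b) :=
  fun w => bin_val w %% v \in [seq slot_row b v (k * b) a' | a' <- l].
have := @card_resample_seq (bits n) (bits b) _ (fun k : 'I_g => get_block b (k * b))
  (fun k => set_block (k * b)) B (2 ^ (b - 10)) xpredT (enum A).
have slot_le (k : 'I_g) : k * b + b <= n.
  by apply: leq_trans le_gb_n; rewrite -mulSnr leq_mul2r ltn_ord orbT.
case/(_ _ _ _ _ _ _)/Wrap; rewrite ?enum_uniq //.
- by move=> k _ x w; rewrite get_set_block.
- by move=> k _ x w; rewrite set_set_block.
- move=> i j _ _ neq_ij x w; rewrite get_set_block_disjoint //.
  rewrite -!mulSnr !leq_mul2r; apply/orP.
  have [?|?|/val_inj e] := ltngtP i j; [left|right|]; rewrite ?orbT //.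
  by rewrite e eqxx in neq_ij.
- move=> k _; rewrite -(@leq_pmul2r (2 ^ 10)) // -expnD subnK //.
  by apply: card_slot_row_mem => //; rewrite size_map.
rewrite -cardE card_bits -!expnM => bound.
rewrite -(leq_pmul2r (expn_gt0 2 ((b - 10) * #|A|))).
have -> : #|[pred a | A \subset old a]| =
    #|[pred t : bits n | true && all (fun i : 'I_g => B i (get_block b (i * b) t)) (enum A)]|.
  apply: eq_card => a; rewrite !inE /=; apply/subsetP/allP => sub k.
    by rewrite mem_enum => /sub; rewrite inE.
  by move=> kA; rewrite inE; apply: sub; rewrite mem_enum.
rewrite -mulnA -expnD -mulnDl subnKC //.
apply: leq_trans bound _; rewrite mulnC leq_mul2r.
by apply/orP; right; rewrite -card_bits; apply: max_card.
Qed.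

(** At least [h] slots are then old; union bound over the [2 ^ g] possible sets of old slots. *)
Lemma card_few_new_slots (h : nat) :
  #|[pred a | size (new_slots b g v l a) + h <= g]| * 2 ^ (10 * h)
    <= 2 ^ g * 2 ^ n.
Proof.
pose C := [pred a : bits n | h <= #|old a|].
have := @leq_card_mem_seq _ _ C old (2 ^ (10 * h)) (2 ^ n) (enum {: {set 'I_g}}).
case/(_ _)/Wrap => [A|].
  have [le_hA|lt_Ah] := leqP h #|A|; last first.
    rewrite eq_card0 // => a; rewrite !inE.
    by apply/andP => -[+ /eqP e]; rewrite e leqNgt lt_Ah.
  apply: leq_trans (card_old_sup A); apply: leq_mul.
    apply: subset_leq_card; apply/subsetP => a; rewrite !inE.
    by move=> /andP[_ /eqP ->].
  by rewrite leq_exp2l // leq_mul2l le_hA.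
have -> : size (enum {: {set 'I_g}}) = 2 ^ g.
  have := card_powerset [set: 'I_g]; rewrite cardsT card_ord -cardE => <-.
  by apply: eq_card => A; rewrite !inE subsetT.
move=> bound; apply: leq_trans bound; rewrite leq_mul2r; apply/orP; right.
apply: subset_leq_card; apply/subsetP => a.
rewrite !inE mem_enum inE andbT size_new_slots.
by have := max_card (old a); rewrite card_ord; lia.
Qed.

End FewNew.

Lemma leq_card_fibersC (A B : finType) (E : pred (A * B)) (k l : nat) :
  (forall b, #|[pred a | E (a, b)]| * k <= l) ->
  #|[pred w | E w]| * k <= l * #|B|.
Proof.
move=> bound; pose sw (w : B * A) := (w.2, w.1).
have swI : injective sw by move=> [? ?] [? ?] [-> ->].
have := @leq_card_fibers _ _ [pred w : B * A | E (sw w)] k l bound.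
have <- // : #|[pred w | E w]| = #|[pred w : B * A | E (sw w)]|.
rewrite -(card_image swI); apply: eq_card => -[a b].
rewrite [RHS](_ : _ = (sw (b, a) \in [seq sw x | x in [pred w | E (sw w)]])) //.
by rewrite mem_image.
Qed.

Lemma leq_card_exists (I T : finType) (F : I -> pred T) (k l : nat) :
  (forall i, #|[pred t | F i t]| * k <= l) ->
  #|[pred t | [exists i, F i t]]| * k <= #|I| * l.
Proof.
move=> bound; rewrite -[leqRHS]sum_nat_const.
apply: leq_trans (_ : \sum_i #|[pred t | F i t]| * k <= _); last exact: leq_sum.
rewrite -big_distrl /=.
rewrite leq_mul2r; apply/orP; right; rewrite -sum1_card.
under [leqRHS]eq_bigr => i _ do rewrite -sum1_card big_mkcond /=.
rewrite exchange_big /= [leqLHS]big_mkcond /=; apply: leq_sum => t _.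
case: ifP => //; rewrite inE => /existsP[i Fit].
by rewrite (bigD1 i) //= inE Fit.
Qed.

(** * Oracle queries *)

Section Queries.
Variable n : nat.
Implicit Types (RO : oracle n) (u v y : bits n).

Definition reprogram RO u v : oracle n := [ffun y => if y == u then v else RO y].

Lemma reprogramE RO u v y : reprogram RO u v y = if y == u then v else RO y.
Proof. exact: ffunE. Qed.

Lemma reprogram_reprogram RO u v w :
  reprogram (reprogram RO u v) u w = reprogram RO u w.
Proof. by apply/ffunP => y; rewrite !reprogramE; case: eqP. Qed.

Lemma reprogram_id RO u : reprogram RO u (RO u) = RO.
Proof. by apply/ffunP => y; rewrite reprogramE; case: eqP => [->|]. Qed.

Fixpoint qlist (A : Type) RO (t : qalg n A) : seq (bits n) :=
  match t with
  | QRet _ => [::]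
  | QAsk u k => u :: qlist RO (k (RO u))
  end.

Lemma size_qlist (A : Type) RO (t : qalg n A) : size (qlist RO t) = qcount RO t.
Proof. by elim: t => //= u k IH; rewrite IH. Qed.

Lemma reprogram_unasked (A : Type) RO (t : qalg n A) u v :
  u \notin qlist RO t ->
  qrun (reprogram RO u v) t = qrun RO t /\
  qlist (reprogram RO u v) t = qlist RO t.
Proof.
elim: t => //= y k IH; rewrite inE negb_or => /andP[neq_uy un].
by rewrite reprogramE [y == u]eq_sym (negbTE neq_uy); have [-> ->] := IH _ un.
Qed.

End Queries.

(** * Progress of a massively parallel computation along the line *)

Section Rounds.
Variables (n m tl S s q b g v : nat) (M : mpc n m tl) (p : 'I_S -> 'I_m).
Variables (z : bits tl).
Implicit Types (RO : oracle n) (x : bits S) (u a : bits n).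

Local Notation mem RO x k j := (mpc_mem M p RO z x k j).
Local Notation asked RO x k j := (qlist RO (M k j (mem RO x k j) z)).
Local Notation ins x a := (fill b g v x g a).
Local Notation state RO x i := (line_state b g v RO x i).
Local Notation node RO x i := (ins x (state RO x i)).

Definition queried k RO x : pred (bits n) :=
  fun u => [exists k' : 'I_k, exists j, u \in asked RO x k' j].

Lemma queriedS k RO x u :
  queried k.+1 RO x u = queried k RO x u || [exists j, u \in asked RO x k j].
Proof.
apply/existsP/orP => [[k']|[/existsP[k' uk']|uk]].
- have [lt_k'k uk'|le_kk' uk'] := ltnP k' k.
    by left; apply/existsP; exists (Ordinal lt_k'k).
  have e : k' = k :> nat by apply/eqP; rewrite eqn_leq le_kk' -ltnS ltn_ord.
  by right; rewrite -e.
- by exists (widen_ord (leqnSn k) k').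
- by exists ord_max.
Qed.

(** The memories up to round [k] are functions of the answers obtained in the rounds before [k]. *)
Lemma mpc_mem_reprogram k RO x u a : ~~ queried k RO x u ->
  forall k', k' <= k -> forall j, mem (reprogram RO u a) x k' j = mem RO x k' j.
Proof.
move=> unq; elim=> [//|k' IH] lt_k'k j /=.
congr flatten; apply: eq_map => j' /=.
rewrite IH 1?ltnW //; have un : u \notin asked RO x k' j'.
  by apply: contra unq => uin; apply/existsP; exists (Ordinal lt_k'k);
     apply/existsP; exists j'.
by have [-> _] := reprogram_unasked a un.
Qed.

Lemma queried_reprogram k RO x u a : ~~ queried k RO x u ->
  queried k (reprogram RO u a) x =1 queried k RO x.
Proof.
move=> unq y; apply: eq_existsb => k'; apply: eq_existsb => j.
rewrite (mpc_mem_reprogram a unq) 1?ltnW //.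
have un : u \notin asked RO x k' j.
  by apply: contra unq => uin; apply/existsP; exists k'; apply/existsP; exists j.
by have [_ ->] := reprogram_unasked a un.
Qed.

Lemma mpc_output_reprogram rd RO x u a : ~~ queried rd.+1 RO x u ->
  mpc_output M p rd (reprogram RO u a) z x = mpc_output M p rd RO z x.
Proof.
move=> unq; congr flatten; apply: eq_map => j /=.
rewrite (mpc_mem_reprogram a unq) //.
have un : u \notin asked RO x rd j.
  by apply: contra unq => uin; rewrite queriedS; apply/orP; right;
     apply/existsP; exists j.
by have [-> _] := reprogram_unasked a un.
Qed.

Lemma line_stateS RO x i : state RO x i.+1 = RO (node RO x i).
Proof. by []. Qed.

(** Freshness ensures that the nodes up to [i] do not use the answer at node [i], which can thus be
    re-drawn without moving them. *)
Definition fresh RO x i := node RO x i \notin [seq node RO x j | j <- iota 0 i].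

Lemma line_state_reprogram RO x i a j : fresh RO x i -> j <= i ->
  state (reprogram RO (node RO x i) a) x j = state RO x j.
Proof.
move=> fr; elim: j => // j IH lt_ji; rewrite !line_stateS IH 1?ltnW // reprogramE.
case: eqP => // e; case/negP: fr; rewrite -e; apply: map_f.
by rewrite mem_iota.
Qed.

Lemma fresh_reprogram RO x i a : fresh RO x i ->
  fresh (reprogram RO (node RO x i) a) x i.
Proof.
move=> fr; rewrite /fresh line_state_reprogram //.
congr (_ \notin _): (fr); apply/eq_in_map => j; rewrite mem_iota => /andP[_ lt_ji].
by rewrite line_state_reprogram 1?ltnW.
Qed.

(** [card_resample] for the coordinate [RO (node RO x i)], which is state [i.+1]. *)
Lemma card_node_resample x i (C : pred (oracle n)) (B : oracle n -> pred (bits n))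
    (k : nat) :
  (forall RO, C RO -> fresh RO x i) ->
  (forall RO a, C RO -> C (reprogram RO (node RO x i) a)) ->
  (forall RO a, C RO -> B (reprogram RO (node RO x i) a) =1 B RO) ->
  (forall RO, C RO -> #|B RO| <= k) ->
  #|[pred RO | C RO && B RO (state RO x i.+1)]| * 2 ^ n <= k * #|{: oracle n}|.
Proof.
move=> Cfresh CR BR Bk.
have := @card_resample (oracle n) (bits n) (fun RO => RO (node RO x i))
  (fun RO a => reprogram RO (node RO x i) a) C B k.
case/(_ _ Bk)/Wrap => [RO a CRO|bound].
  split; [exact: CR| | |exact: BR].
    by rewrite line_state_reprogram ?Cfresh // reprogramE eqxx.
  by rewrite line_state_reprogram ?Cfresh // reprogram_reprogram reprogram_id.
rewrite card_bits in bound; apply: leq_trans bound _.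
by rewrite leq_mul2l max_card orbT.
Qed.

Hypotheses (b_gt0 : 0 < b) (v_gt0 : 0 < v).
Hypotheses (le_gb_n : g * b <= n) (le_vgb_S : v * (g * b) <= S).

(** Node [i.+1] falls on one of the [i.+1] earlier nodes only if the answer at node [i] is one of
    their preimages, at most [2 ^ (g * b)] each. *)
Lemma card_collision x i :
  #|[pred RO | fresh RO x i && ~~ fresh RO x i.+1]| * 2 ^ n
    <= (i.+1 * 2 ^ (g * b)) * #|{: oracle n}|.
Proof.
pose nodes RO := [seq node RO x j | j <- iota 0 i.+1].
have := @card_node_resample x i (fun RO => fresh RO x i)
  (fun RO a => ins x a \in nodes RO) (i.+1 * 2 ^ (g * b)).
case/(_ _ _ _ _)/Wrap => //.
- by move=> RO a; apply: fresh_reprogram.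
- move=> RO a fr y; congr (_ \in _); apply/eq_in_map => j.
  by rewrite mem_iota => /andP[_ lt_ji]; rewrite line_state_reprogram.
- move=> RO _; have := card_ins_mem b_gt0 v_gt0 le_gb_n le_vgb_S x (nodes RO).
  by rewrite size_map size_iota.
move=> bound; apply: leq_trans bound; rewrite leq_mul2r; apply/orP; right.
by apply: subset_leq_card; apply/subsetP => RO; rewrite !inE negbK.
Qed.

(* The answers to the query u after which the computation t asks the successor
   of u on the line. *)
Definition advance (A : Type) RO x u (t : qalg n A) : pred (bits n) :=
  fun a => ins x a \in qlist (reprogram RO u a) t.

(** Chosen to be invariant when the answer at node [i] is re-drawn. Node [i] may be asked in round
    [k] itself, since [queried k] stops before it. *)
Definition stuck k j i kap RO x :=
  [&& fresh RO x i, ~~ queried k RO x (node RO x i)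
    & #|advance RO x (node RO x i) (M k j (mem RO x k j) z)| <= kap].

(** If the next node is asked, the true answer at node [i] lies in [advance], a set of at most [kap]
    elements that ignores this answer. *)
Lemma card_advance x k j i kap :
  #|[pred RO | stuck k j i kap RO x && (node RO x i.+1 \in asked RO x k j)]|
    * 2 ^ n <= kap * #|{: oracle n}|.
Proof.
pose B RO := advance RO x (node RO x i) (M k j (mem RO x k j) z).
have BR RO a : stuck k j i kap RO x ->
    B (reprogram RO (node RO x i) a) =1 B RO.
  move=> /and3P[fr unq _] y; rewrite /B line_state_reprogram // /advance.
  by rewrite reprogram_reprogram (mpc_mem_reprogram a unq).
have := @card_node_resample x i (fun RO => stuck k j i kap RO x) B kap.
case/(_ _ _ BR _)/Wrap.
- by move=> RO /and3P[].
- move=> RO a st; have /and3P[fr unq le_kap] := st; apply/and3P; split.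
  + exact: fresh_reprogram.
  + by rewrite queried_reprogram // line_state_reprogram.
  + by apply: leq_trans le_kap; rewrite (eq_card (BR RO a st)).
- by move=> RO /and3P[].
move=> bound; apply: leq_trans bound; rewrite leq_mul2r; apply/orP; right.
apply: subset_leq_card; apply/subsetP => RO; rewrite !inE => /andP[-> succ_in].
by rewrite /B /advance line_stateS reprogram_id -line_stateS.
Qed.

(** An output computed without asking node [i] does not depend on the answer there, and it equals at
    most one possible answer. *)
Lemma card_lucky_output x rd i :
  #|[pred RO | [&& fresh RO x i, ~~ queried rd.+1 RO x (node RO x i)
       & mpc_output M p rd RO z x == state RO x i.+1 :> seq bool]]|
    * 2 ^ n <= #|{: oracle n}|.
Proof.
pose C RO := fresh RO x i && ~~ queried rd.+1 RO x (node RO x i).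
pose B RO := [pred a : bits n | mpc_output M p rd RO z x == a :> seq bool].
have := @card_node_resample x i C B 1; rewrite mul1n.
case/(_ _ _ _ _)/Wrap.
- by move=> RO /andP[].
- move=> RO a /andP[fr unq]; apply/andP; split; first exact: fresh_reprogram.
  by rewrite queried_reprogram // line_state_reprogram.
- by move=> RO a /andP[fr unq] y; rewrite /= mpc_output_reprogram.
- move=> RO _; rewrite leqNgt; apply/negP => /card_gt1P[a [a' []]].
  rewrite !inE => /eqP ea /eqP ea' /eqP; case; apply: val_inj.
  by rewrite /= -ea -ea'.
move=> bound; apply: leq_trans bound; rewrite leq_mul2r; apply/orP; right.
by apply: subset_leq_card; apply/subsetP => RO; rewrite !inE /C andbA.
Qed.

(* Truncating the lists of queries to q elements changes nothing for memories
   that actually occur. *)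
Definition foresees k j kap RO x (w : 'I_s.+1 * bits s) :=
  let t := M k j (take w.1 w.2) z in
  has (fun u => kap <= #|[pred a | ins x a \in take q (qlist (reprogram RO u a) t)]|)
    (take q (qlist RO t)).

(** The actual memory depends on [x], so the union bound runs over all memories of at most [s] bits,
    then over the queries [u]. Each choice fixes a function [L] independent of [x]. *)
Lemma card_foresees k j kap RO (e : nat) :
  (forall L : bits n -> seq (bits n), (forall a, size (L a) <= q) ->
     #|[pred x : bits S | kap <= #|[pred a | ins x a \in L a]|]| * e <= 2 ^ S) ->
  #|[pred x | [exists w, foresees k j kap RO x w]]| * e
    <= s.+1 * 2 ^ s * (q * 2 ^ S).
Proof.
move=> Lbound.
have card_w : #|{: 'I_s.+1 * bits s}| = s.+1 * 2 ^ s.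
  by rewrite card_prod card_ord card_bits.
rewrite -card_w; apply: leq_card_exists => w.
set t := M k j (take w.1 w.2) z.
set us := take q (qlist RO t).
have size_us : size us <= q by rewrite size_take_min geq_minl.
apply: leq_trans (_ : size us * 2 ^ S <= _); last by rewrite leq_mul2r size_us orbT.
rewrite /foresees -/t -/us.
elim: us {size_us} => [|u us IH] /=; first by rewrite eq_card0.
rewrite mulSn; apply: leq_trans (leq_add (Lbound
  (fun a => take q (qlist (reprogram RO u a) t)) _) IH); last first.
  by move=> a; rewrite size_take_min geq_minl.
rewrite -mulnDl leq_mul2r; apply/orP; right.
rewrite -cardUI; apply: leq_trans (leq_addr _ _); apply: subset_leq_card.
by apply/subsetP => x; rewrite !inE.
Qed.

Lemma take_pad (sg : seq bool) : size sg <= s ->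
  exists w : 'I_s.+1 * bits s, take w.1 w.2 = sg.
Proof.
move=> le_s; have [w wE] : exists w : bits s, forall i, nth false w i = (i < s) && nth false sg i.
  by exists [tuple nth false sg i | i < s] => i; apply: nth_mktuple_bits.
exists (inord (size sg), w) => /=.
rewrite inordK ?ltnS //; apply: (@eq_from_nth _ false).
  by rewrite size_take_min size_tuple (minn_idPl le_s).
move=> i; rewrite size_take_min size_tuple (minn_idPl le_s) => lt_i.
by rewrite nth_take // wE (leq_trans lt_i).
Qed.

Variables (rd T kap e : nat).
Hypothesis withinM : mpc_within M p rd s q.
Hypotheses (lt_rdT : rd.+1 < T) (le_q_kap : q * 2 ^ (g * b) <= kap).

Lemma stuck_or_foresees k j i RO x : k <= rd ->
  fresh RO x i -> ~~ queried k RO x (node RO x i) ->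
  ~~ [exists w, foresees k j kap RO x w] -> stuck k j i kap RO x.
Proof.
move=> le_k fr unq nfs; rewrite /stuck fr unq /=.
have [size_mem size_q] := withinM RO z x j le_k.
have [w ew] := take_pad size_mem.
(* If node [i] is not asked, its answer does not affect the queries and [card_ins_mem] suffices. *)
have [ask|unask] := boolP (node RO x i \in asked RO x k j); last first.
  apply: leq_trans le_q_kap.
  apply: leq_trans (_ : size (asked RO x k j) * 2 ^ (g * b) <= _); last first.
    by rewrite leq_mul2r size_qlist size_q orbT.
  apply: leq_trans (card_ins_mem b_gt0 v_gt0 le_gb_n le_vgb_S x (asked RO x k j)).
  apply: subset_leq_card; apply/subsetP => a; rewrite unfold_in /advance.
  by have [_ ->] := reprogram_unasked a unask; rewrite inE.
rewrite leqNgt; apply: contra nfs => lt_kap.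
apply/existsP; exists w; apply/hasP; rewrite ew.
exists (node RO x i); first by rewrite take_oversize // size_qlist.
apply: leq_trans (ltnW lt_kap) _; apply: subset_leq_card; apply/subsetP => a.
rewrite unfold_in /advance inE take_oversize // size_qlist.
(* The re-programmed oracle yields the same memory, so its queries also obey the bound [q] and
   truncation loses none. *)
have [_] := withinM (reprogram RO (node RO x i) a) z x j le_k.
by rewrite (mpc_mem_reprogram a unq).
Qed.

(** Outside the first three events, the rounds before [k] ask no node of index at least [k]. As
    [rd.+1 < T], node [T.-1] is never asked and the output is a guess. *)
Lemma success_cases RO x :
  mpc_output M p rd RO z x == state RO x T :> seq bool ->
  [|| [exists i : 'I_T, fresh RO x i && ~~ fresh RO x i.+1],
      [exists kj : 'I_T * 'I_m, [exists w, foresees kj.1 kj.2 kap RO x w]],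
      [exists kji : 'I_T * 'I_m * 'I_T,
         let: (k, j, i) := kji in
         stuck k j i kap RO x && (node RO x i.+1 \in asked RO x k j)]
    | [&& fresh RO x T.-1, ~~ queried rd.+1 RO x (node RO x T.-1)
        & mpc_output M p rd RO z x == state RO x T.-1.+1 :> seq bool]].
Proof.
move=> succ; apply/negPn/negP; rewrite !negb_or => /and4P[].
move=> /existsPn noE1 /existsPn noE2 /existsPn noE3.
have frT i : i < T -> fresh RO x i.
  elim: i => [|i IH] lt_i; first by rewrite /fresh.
  have := noE1 (Ordinal (ltnW lt_i)); rewrite negb_and negbK /= IH 1?ltnW //.
have unq k : k <= rd.+1 -> forall i, k <= i < T -> ~~ queried k RO x (node RO x i).
  elim: k => [_ i _|k IH lt_k i /andP[lt_ki lt_iT]].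
    by apply/existsPn => -[].
  rewrite queriedS negb_or IH ?(ltnW lt_k) ?(ltnW lt_ki) //=.
  (* Node [i], with [k <= i], was not queried before round [k]; hence [stuck] holds there and node
     [i.+1] is out of reach in round [k]. *)
  case: i lt_ki lt_iT => // i le_ki lt_iT.
  have lt_kT : k < T by lia.
  apply/existsPn => j; have := noE3 (Ordinal lt_kT, j, Ordinal (ltnW lt_iT)).
  rewrite negb_and /=; apply: contraTN => -> /=; rewrite orbF negbK.
  apply: stuck_or_foresees => //; first by rewrite frT // ltnW.
    by rewrite IH ?(ltnW lt_k) //; lia.
  exact: noE2 (Ordinal lt_kT, j).
have T_gt0 : 0 < T by lia.
rewrite prednK // succ andbT frT ?prednK //= negbK.
by apply/negP/unq => //; lia.
Qed.

Hypothesis le_coll : T * 2 ^ (g * b) * 2 ^ e <= 2 ^ n.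
Hypothesis le_kap : kap * 2 ^ e <= 2 ^ n.
Hypothesis Lbound : forall L : bits n -> seq (bits n), (forall a, size (L a) <= q) ->
  #|[pred x : bits S | kap <= #|[pred a | ins x a \in L a]|]|
    * (s.+1 * 2 ^ s * q * 2 ^ e) <= 2 ^ S.
Hypothesis le_e : (T + T * m + T * m * T + 1) * 4 <= 2 ^ e.

(** Each event of [success_cases] has proportion at most [1 / 2 ^ e]; [le_e] pays for the union over
    rounds, machines and nodes. *)
Lemma card_success :
  #|[pred w : oracle n * bits S |
      mpc_output M p rd w.1 z w.2 == state w.1 w.2 T :> seq bool]| * 4
    <= #|{: oracle n * bits S}|.
Proof.
set W := #|{: oracle n * bits S}|.
have W_E : W = #|{: oracle n}| * 2 ^ S by rewrite /W card_prod card_bits.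
have two_ngt0 : 0 < 2 ^ n by rewrite expn_gt0.
have scale (E : pred (oracle n)) k : k * 2 ^ e <= 2 ^ n ->
    #|[pred RO | E RO]| * 2 ^ n <= k * #|{: oracle n}| ->
    #|[pred RO | E RO]| * 2 ^ e <= #|{: oracle n}|.
  move=> le1 le2; rewrite -(leq_pmul2r two_ngt0) mulnAC.
  apply: leq_trans (leq_mul le2 (leqnn _)) _.
  by rewrite mulnAC mulnC leq_mul2l le1 orbT.
have overx (E : oracle n -> bits S -> bool) :
    (forall x, #|[pred RO | E RO x]| * 2 ^ e <= #|{: oracle n}|) ->
    #|[pred w : oracle n * bits S | E w.1 w.2]| * 2 ^ e <= W.
  move=> Ex; rewrite W_E -(card_bits S).
  exact: (@leq_card_fibersC _ _ (fun w => E w.1 w.2)).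
have E1 (i : 'I_T) : #|[pred w : oracle n * bits S |
    fresh w.1 w.2 i && ~~ fresh w.1 w.2 i.+1]| * 2 ^ e <= W.
  apply: (overx (fun RO x => fresh RO x i && ~~ fresh RO x i.+1)) => x.
  apply: scale (card_collision x i).
  apply: leq_trans le_coll; rewrite leq_mul2r; apply/orP; right.
  by rewrite leq_mul2r ltn_ord orbT.
have E2 (kj : 'I_T * 'I_m) : #|[pred w : oracle n * bits S |
    [exists sg, foresees kj.1 kj.2 kap w.1 w.2 sg]]| * 2 ^ e <= W.
  rewrite W_E [leqRHS]mulnC.
  apply: (@leq_card_fibers _ _
    (fun w => [exists sg, foresees kj.1 kj.2 kap w.1 w.2 sg])) => RO.
  have := card_foresees kj.1 kj.2 RO Lbound.
  have [q0|q_gt0] := posnP q.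
    move=> _; rewrite eq_card0 // => x; rewrite !inE /=.
    by apply/existsPn => sg; rewrite /foresees q0 !take0.
  set A := #|_|; rewrite -(@leq_pmul2r (s.+1 * 2 ^ s * q) (A * 2 ^ e)); last first.
    by rewrite !muln_gt0 expn_gt0.
  lia.
have E3 (kji : 'I_T * 'I_m * 'I_T) : #|[pred w : oracle n * bits S |
    let: (k, j, i) := kji in
    stuck k j i kap w.1 w.2 && (node w.1 w.2 i.+1 \in asked w.1 w.2 k j)]|
      * 2 ^ e <= W.
  case: kji => -[k j] i; apply: (overx (fun RO x =>
    stuck k j i kap RO x && (node RO x i.+1 \in asked RO x k j))) => x.
  exact: scale le_kap (card_advance x k j i kap).
have E4 : #|[pred w : oracle n * bits S |
    [&& fresh w.1 w.2 T.-1, ~~ queried rd.+1 w.1 w.2 (node w.1 w.2 T.-1)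
      & mpc_output M p rd w.1 z w.2 == state w.1 w.2 T.-1.+1 :> seq bool]]|
      * 2 ^ e <= W.
  apply: (overx (fun RO x =>
    [&& fresh RO x T.-1, ~~ queried rd.+1 RO x (node RO x T.-1)
      & mpc_output M p rd RO z x == state RO x T.-1.+1 :> seq bool])) => x.
  apply: (@scale _ 1); last first.
    by rewrite mul1n; apply: card_lucky_output.
  rewrite mul1n; apply: leq_trans le_coll; apply: leq_pmull.
  by rewrite muln_gt0 expn_gt0 andbT; lia.
have {}E1 := leq_card_exists E1; have {}E2 := leq_card_exists E2.
have {}E3 := leq_card_exists E3.
rewrite !card_prod !card_ord in E1 E2 E3.
set A := #|_|; suff : A * 2 ^ e <= (T + T * m + T * m * T + 1) * W.
  move=> bound; rewrite -(leq_pmul2r (expn_gt0 2 e)) mulnAC.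
  apply: leq_trans (leq_mul bound (leqnn 4)) _.
  by rewrite mulnAC mulnC leq_mul2l le_e orbT.
rewrite !mulnDl mul1n.
apply: leq_trans (leq_add (leq_add (leq_add E1 E2) E3) E4).
rewrite -!mulnDl leq_mul2r; apply/orP; right.
rewrite -!addnA.
have leU (P Q : pred (oracle n * bits S)) (k : nat) :
    #|[pred w | Q w]| <= k -> #|[pred w | P w || Q w]| <= #|[pred w | P w]| + k.
  move=> le_k; apply: leq_trans (leq_add (leqnn _) le_k); rewrite -cardUI.
  apply: leq_trans (leq_addr _ _); apply: subset_leq_card.
  by apply/subsetP => w; rewrite !inE.
apply: leq_trans (leU _ _ _ (leU _ _ _ (leU _ _ _ (leqnn _)))).
by apply: subset_leq_card; apply/subsetP => -[RO x]; apply: success_cases.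
Qed.

End Rounds.

(** * Choice of the parameters *)

Section Dimensions.
Variables (n S h s q : nat).
Hypotheses (h_ge : 40 <= h) (le_h_n : 144 * (h * h) <= n) (le_nS : n <= S).
Hypotheses (le_S : S <= 2 ^ h) (le_q : q <= 2 ^ (36 * (h.+1 * h.+1))).
Hypothesis le_s : s * 2 ^ 17 <= S.

Local Notation b := (12 * h).
Local Notation g := (8 * h).
Local Notation v := (S %/ (g * b)).
Local Notation ins x a := (fill b g v x g a).

Let b_gt0 : 0 < b. Proof. by lia. Qed.
Let gb_E : g * b = 96 * (h * h). Proof. by lia. Qed.
Let gb_gt0 : 0 < g * b. Proof. by nia. Qed.
Let v_gt0 : 0 < v. Proof. by rewrite divn_gt0 //; lia. Qed.
Let le_gb_n : g * b <= n. Proof. by lia. Qed.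
Let le_vgb_S : v * (g * b) <= S. Proof. exact: leq_divM. Qed.

(** [card_hits_moment] with [gam = 2 ^ (n - 2 * h)] and [D = 7 * h]: each of the [t] answers gains
    [84 * h ^ 2] bits and costs [Q] bits for the guesses and [2 * h] for [gam]. *)
Lemma card_foresight (L : bits n -> seq (bits n)) :
  (forall a, size (L a) <= q) ->
  #|[pred x : bits S |
      2 ^ (n - 2 * h) + 2 ^ (n - 2 * h) <= #|[pred a | ins x a \in L a]|]|
    * (s.+1 * 2 ^ s * q * 2 ^ h) <= 2 ^ S.
Proof.
move=> size_L; set Xb := [pred x | _].
(* The largest [t] such that lists shorter than [t] satisfy [size l * 2 ^ 11 <= v], as
   [card_few_new_slots] requires. *)
pose t := (v %/ 2 ^ 11).+1; pose Q := 36 * (h.+1 * h.+1).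
have le_v : v <= 2 ^ b.
  apply: leq_trans (leq_div _ _) (leq_trans le_S _); rewrite leq_exp2l //; lia.
have le_hn : 2 * h <= n by nia.
have bad_le (l : seq (bits n)) : size l < t ->
    #|[pred a | size (new_slots b g v l a) < 7 * h]| <= 2 ^ (n - 2 * h).
  rewrite ltnS leq_divRL // => le_l.
  have b_ge : 10 <= b by lia.
  have := card_few_new_slots b_ge v_gt0 le_gb_n le_v le_l h.
  rewrite -expnD => bound.
  rewrite -(leq_pmul2r (expn_gt0 2 (10 * h))) -expnD.
  (* The [2 ^ g] sets of slots exactly use up the gap between [10 * h] and [2 * h]. *)
  have -> : n - 2 * h + 10 * h = g + n by lia.
  apply: leq_trans bound; rewrite leq_mul2r; apply/orP; right.
  by apply: subset_leq_card; apply/subsetP => a; rewrite !inE; lia.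
have := card_hits_moment b_gt0 v_gt0 le_gb_n le_vgb_S size_L
  (fun x (Xbx : Xb x) => Xbx) bad_le.
set A := #|_| => moment.
have {moment} moment : A * 2 ^ (7 * h * b * t) <= 2 ^ ((2 * h + Q) * t + S).
  rewrite -(leq_pmul2r (expn_gt0 2 ((n - 2 * h) * t))) -expnD mulnAC.
  rewrite [A * _]mulnC expnM.
  apply: leq_trans moment _; rewrite expnMn -!expnM -mulnA.
  have -> : (2 * h + Q) * t + S + (n - 2 * h) * t = n * t + (Q * t + S) by nia.
  rewrite 2!expnD leq_mul // leq_mul // [leqRHS]expnM.
  by rewrite leq_exp2r.
(* Origin of the constant [2 ^ 17]: [S < 2 * v * (g * b)], [v < t * 2 ^ 11] and
   [2 * 2 ^ 11 * 96 = 3 * 2 ^ 17]. *)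
have s_t : s <= 3 * (h * h) * t.
  have lt_v : v < t * 2 ^ 11 by rewrite ltn_ceil ?expn_gt0.
  have lt_S : S < v.+1 * (g * b) by rewrite ltn_ceil.
  have : s * 2 ^ 17 <= 3 * (h * h) * t * 2 ^ 17.
    apply: leq_trans le_s (leq_trans (ltnW lt_S) _).
    apply: leq_trans (leq_mul (_ : v.+1 <= 2 * v) (leqnn _)) _; first by lia.
    have -> : 3 * (h * h) * t * 2 ^ 17 = 2 * (t * 2 ^ 11) * (g * b).
      by rewrite gb_E (expnD 2 11 6); lia.
    by rewrite leq_mul2r leq_mul2l (ltnW lt_v) !orbT.
  by rewrite leq_pmul2r // expn_gt0.
have le_mult : s.+1 * 2 ^ s * q * 2 ^ h <= 2 ^ (s + s + Q + h).
  rewrite !expnD; do 3!apply: leq_mul => //; exact: ltn_expl.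
rewrite -(leq_pmul2r (expn_gt0 2 (7 * h * b * t))).
apply: leq_trans (_ : A * 2 ^ (7 * h * b * t) * 2 ^ (s + s + Q + h) <= _).
  by rewrite mulnAC leq_mul2l le_mult orbT.
apply: leq_trans (leq_mul moment (leqnn _)) _.
rewrite -!expnD leq_exp2l // [leqRHS]addnC addnAC leq_add2r.
have t_gt0 : 0 < t by [].
(* Per answer, [2 * s] takes [6 * h ^ 2] of the [84 * h ^ 2] bits; the other 78 must cover [Q] twice
   and [3 * h]. *)
have : (2 * Q + 3 * h) * t <= 78 * (h * h) * t.
  rewrite leq_mul2r; apply/orP; right; rewrite /Q; nia.
have le_Qt : Q <= Q * t by rewrite leq_pmulr.
have le_ht : h <= h * t by rewrite leq_pmulr.
by lia.
Qed.

Lemma card_line_success (m tl T rd : nat) (M : mpc n m tl) (p : 'I_S -> 'I_m)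
    (z : bits tl) :
  T <= 2 ^ (h %/ 4) -> m <= 2 ^ (h %/ 4) -> mpc_within M p rd s q -> rd.+1 < T ->
  #|[pred w : oracle n * bits S |
      mpc_output M p rd w.1 z w.2 == line_state b g v w.1 w.2 T :> seq bool]| * 4
    <= #|{: oracle n * bits S}|.
Proof.
move=> le_T le_m withinM lt_rd.
have le_hn : 2 * h <= n by nia.
have le_Th : T <= 2 ^ h by apply: leq_trans le_T _; rewrite leq_exp2l //; lia.
apply: (@card_success n m tl S s q b g v M p z b_gt0 v_gt0 le_gb_n le_vgb_S rd T
  (2 ^ (n - 2 * h) + 2 ^ (n - 2 * h)) h) => //.
- rewrite gb_E addnn -mul2n -expnS.
  apply: leq_trans (leq_mul le_q (leqnn _)) _; rewrite -expnD leq_exp2l //.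
  by nia.
- rewrite gb_E; apply: leq_trans (leq_mul (leq_mul le_Th (leqnn _)) (leqnn _)) _.
  by rewrite -!expnD leq_exp2l //; nia.
- by rewrite addnn -mul2n -expnS -expnD leq_exp2l //; lia.
- exact: card_foresight.
(* The union has at most [4 * E ^ 3] events, and [16 * E ^ 3 <= 2 ^ h] because [h >= 40]. *)
- set E := 2 ^ (h %/ 4) in le_T le_m.
  have E_gt0 : 0 < E by rewrite expn_gt0.
  apply: (@leq_trans (E * E * E * 16)).
    have le_Tm : T * m <= E * E by apply: leq_mul.
    have le_TmT : T * m * T <= E * E * E by apply: leq_mul.
    have le_E : E * E <= E * E * E by rewrite leq_pmulr.
    have le_E' : E <= E * E by rewrite leq_pmulr.
    by lia.
  rewrite -[16]/(2 ^ 4) /E -!expnD leq_exp2l //; lia.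
Qed.

End Dimensions.

Lemma card_success_tape (n S m tl rd : nat) (M : mpc n m tl) (p : 'I_S -> 'I_m)
    (f : oracle n -> bits S -> bits n) (k : nat) :
  (forall z, #|[pred w : oracle n * bits S |
     mpc_output M p rd w.1 z w.2 == f w.1 w.2 :> seq bool]| * k
       <= #|{: oracle n * bits S}|) ->
  #|[pred w : oracle n * bits tl * bits S |
      mpc_output M p rd w.1.1 w.1.2 w.2 == f w.1.1 w.2 :> seq bool]| * k
    <= #|{: oracle n * bits tl * bits S}|.
Proof.
move=> bound.
pose E (y : bits tl * (oracle n * bits S)) :=
  mpc_output M p rd y.2.1 y.1 y.2.2 == f y.2.1 y.2.2 :> seq bool.
have := @leq_card_fibers _ _ E k #|{: oracle n * bits S}| bound.
have -> : #|{: oracle n * bits S}| * #|{: bits tl}| =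
    #|{: oracle n * bits tl * bits S}| by rewrite !card_prod mulnAC.
apply: leq_trans; rewrite leq_mul2r; apply/orP; right.
pose phi (w : oracle n * bits tl * bits S) := (w.1.2, (w.1.1, w.2)).
have phiI : injective phi by move=> [[? ?] ?] [[? ?] ?] [-> -> ->].
rewrite -(card_image phiI); apply: subset_leq_card; apply/subsetP => y.
by case/imageP => -[[RO z] x] Ew ->.
Qed.

(** * The random access machine *)

Local Notation rg k := (@Ordinal 16 k isT).

(* Registers: 0, 1, 2 hold n, S and the number of remaining steps; 3 holds 1; 4 to
   8 hold h, b, g, g * b and v; 9 is the offset of the current slot, 10 the number
   of remaining slots, 11 the number of remaining bits; 12 is the row being decoded
   or the source address, 13 the address being read or written, 14 is scratch and
   15 holds 0. The state is kept at address S. *)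
Definition line_code : seq (instr 16) := [::
  IConst (rg 3) 1;
  IAdd (rg 4) (rg 4) (rg 3);
  IConst (rg 14) 144;
  IMul (rg 13) (rg 4) (rg 4);
  IMul (rg 14) (rg 14) (rg 13);
  ISub (rg 14) (rg 14) (rg 0);
  IJz (rg 14) 1;
  ISub (rg 4) (rg 4) (rg 3);
  IConst (rg 14) 12;
  IMul (rg 5) (rg 14) (rg 4);
  IConst (rg 14) 8;
  IMul (rg 6) (rg 14) (rg 4);
  IMul (rg 7) (rg 6) (rg 5);
  IDiv (rg 8) (rg 1) (rg 7);
  (* 14: next step *)
  IJz (rg 2) 48;
  IConst (rg 9) 0;
  IMove (rg 10) (rg 6);
  (* 17: next slot *)
  IJz (rg 10) 45;
  IConst (rg 12) 0;
  IMove (rg 11) (rg 5);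
  IAdd (rg 13) (rg 1) (rg 9);
  (* 21: decode the slot modulo v *)
  IJz (rg 11) 31;
  ILoad (rg 14) (rg 13);
  IAdd (rg 12) (rg 12) (rg 12);
  IAdd (rg 12) (rg 12) (rg 14);
  IDiv (rg 14) (rg 12) (rg 8);
  IMul (rg 14) (rg 14) (rg 8);
  ISub (rg 12) (rg 12) (rg 14);
  IAdd (rg 13) (rg 13) (rg 3);
  ISub (rg 11) (rg 11) (rg 3);
  IJz (rg 15) 21;
  (* 31 *)
  IMul (rg 12) (rg 12) (rg 7);
  IAdd (rg 12) (rg 12) (rg 9);
  IAdd (rg 13) (rg 1) (rg 9);
  IMove (rg 11) (rg 5);
  (* 35: copy the part of the row into the slot *)
  IJz (rg 11) 42;
  ILoad (rg 14) (rg 12);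
  IStore (rg 13) (rg 14);
  IAdd (rg 12) (rg 12) (rg 3);
  IAdd (rg 13) (rg 13) (rg 3);
  ISub (rg 11) (rg 11) (rg 3);
  IJz (rg 15) 35;
  (* 42 *)
  IAdd (rg 9) (rg 9) (rg 5);
  ISub (rg 10) (rg 10) (rg 3);
  IJz (rg 15) 17;
  (* 45: all slots are filled *)
  IAsk (rg 1) (rg 1);
  ISub (rg 2) (rg 2) (rg 3);
  IJz (rg 15) 14;
  (* 48: copy the last state to address 0 *)
  IMove (rg 12) (rg 1);
  IConst (rg 13) 0;
  IMove (rg 11) (rg 0);
  (* 51 *)
  IJz (rg 11) 58;
  ILoad (rg 14) (rg 12);
  IStore (rg 13) (rg 14);
  IAdd (rg 12) (rg 12) (rg 3);
  IAdd (rg 13) (rg 13) (rg 3);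
  ISub (rg 11) (rg 11) (rg 3);
  IJz (rg 15) 51;
  (* 58 *)
  IHalt].

Definition regs (r : nat) (l : seq nat) : 'I_r -> nat := fun i => nth 0 l i.

Lemma upd_regs (r : nat) (l : seq nat) (d : 'I_r) (w : nat) :
  upd (regs l) d w = regs (set_nth 0 l d w).
Proof.
by apply/funext => i; rewrite /upd /regs nth_set_nth /= -(inj_eq val_inj).
Qed.

Section Execution.
Variables (r n W M : nat) (RO : oracle n) (code : seq (instr r)).

(** [ram_run] only describes halting runs, so a partial run is expressed by its effect on every
    halting continuation; [t] is only an upper bound on its cost. *)
Definition reach (t : nat) (c c' : config r) : Prop :=
  forall t0 c'', ram_run W M RO code t0 c' c'' ->
    exists2 t1, t1 <= t + t0 & ram_run W M RO code t1 c c''.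

Lemma reach_refl c : reach 0 c c.
Proof. by move=> t0 c'' run; exists t0. Qed.

Lemma reach_trans t1 t2 c c' c'' :
  reach t1 c c' -> reach t2 c' c'' -> reach (t1 + t2) c c''.
Proof.
move=> r1 r2 t0 d run; have [u le_u run'] := r2 _ _ run.
have [w le_w run''] := r1 _ _ run'; exists w => //.
by rewrite -addnA; apply: leq_trans le_w _; rewrite leq_add2l.
Qed.

Lemma reach_le t1 t2 c c' : t1 <= t2 -> reach t1 c c' -> reach t2 c c'.
Proof.
move=> le12 r1 t0 d run; have [u le_u run'] := r1 _ _ run; exists u => //.
by apply: leq_trans le_u _; rewrite leq_add2r.
Qed.

Lemma reach_step t c c' c'' k : ram_step W M RO code c = Some c' ->
  instr_cost n (nth IHalt code (cfg_pc c)) = k ->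
  reach t c' c'' -> reach (k + t) c c''.
Proof.
move=> step <- r1 t0 d run; have [u le_u run'] := r1 _ _ run.
exists (instr_cost n (nth IHalt code (cfg_pc c)) + u); last exact: RunStep step run'.
by rewrite -addnA leq_add2l.
Qed.

Variables (pc : nat) (l : seq nat) (m : nat -> bool) (c : config r) (t : nat).
Implicit Types (d a b : 'I_r).

Let write_reg d w : w < 2 ^ W -> 
  (if w < 2 ^ W then Some (Config pc.+1 (upd (regs l) d w) m) else None)
    = Some (Config pc.+1 (regs (set_nth 0 l d w)) m).
Proof. by move=> ->; rewrite upd_regs. Qed.

Lemma exec_const d k : nth IHalt code pc = IConst d k -> k < 2 ^ W ->
  reach t (Config pc.+1 (regs (set_nth 0 l d k)) m) c ->
  reach t.+1 (Config pc (regs l) m) c.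
Proof.
by move=> e lt_w; apply: (@reach_step t _ _ _ 1); rewrite /= e //= write_reg.
Qed.

Lemma exec_move d a : nth IHalt code pc = IMove d a -> nth 0 l a < 2 ^ W ->
  reach t (Config pc.+1 (regs (set_nth 0 l d (nth 0 l a))) m) c ->
  reach t.+1 (Config pc (regs l) m) c.
Proof.
by move=> e lt_w; apply: (@reach_step t _ _ _ 1); rewrite /= e //= write_reg.
Qed.

Lemma exec_add d a b : nth IHalt code pc = IAdd d a b ->
  nth 0 l a + nth 0 l b < 2 ^ W ->
  reach t (Config pc.+1 (regs (set_nth 0 l d (nth 0 l a + nth 0 l b))) m) c ->
  reach t.+1 (Config pc (regs l) m) c.
Proof.
by move=> e lt_w; apply: (@reach_step t _ _ _ 1); rewrite /= e //= write_reg.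
Qed.

Lemma exec_sub d a b : nth IHalt code pc = ISub d a b ->
  nth 0 l a - nth 0 l b < 2 ^ W ->
  reach t (Config pc.+1 (regs (set_nth 0 l d (nth 0 l a - nth 0 l b))) m) c ->
  reach t.+1 (Config pc (regs l) m) c.
Proof.
by move=> e lt_w; apply: (@reach_step t _ _ _ 1); rewrite /= e //= write_reg.
Qed.

Lemma exec_mul d a b : nth IHalt code pc = IMul d a b ->
  nth 0 l a * nth 0 l b < 2 ^ W ->
  reach t (Config pc.+1 (regs (set_nth 0 l d (nth 0 l a * nth 0 l b))) m) c ->
  reach t.+1 (Config pc (regs l) m) c.
Proof.
by move=> e lt_w; apply: (@reach_step t _ _ _ 1); rewrite /= e //= write_reg.
Qed.

Lemma exec_div d a b : nth IHalt code pc = IDiv d a b ->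
  nth 0 l a %/ nth 0 l b < 2 ^ W ->
  reach t (Config pc.+1 (regs (set_nth 0 l d (nth 0 l a %/ nth 0 l b))) m) c ->
  reach t.+1 (Config pc (regs l) m) c.
Proof.
by move=> e lt_w; apply: (@reach_step t _ _ _ 1); rewrite /= e //= write_reg.
Qed.

Lemma exec_load d a : nth IHalt code pc = ILoad d a ->
  nth 0 l a < M -> 1 < 2 ^ W ->
  reach t (Config pc.+1 (regs (set_nth 0 l d (m (nth 0 l a)))) m) c ->
  reach t.+1 (Config pc (regs l) m) c.
Proof.
move=> e lt_M lt_w; apply: (@reach_step t _ _ _ 1); rewrite /= e //=.
by rewrite {1}/regs lt_M write_reg //; apply: leq_ltn_trans lt_w; case: (m _).
Qed.

Lemma exec_store a b : nth IHalt code pc = IStore a b -> nth 0 l a < M ->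
  reach t (Config pc.+1 (regs l) (upd m (nth 0 l a) (nth 0 l b != 0))) c ->
  reach t.+1 (Config pc (regs l) m) c.
Proof.
move=> e lt_M; apply: (@reach_step t _ _ _ 1); rewrite /= e //=.
by rewrite {1}/regs lt_M.
Qed.

Lemma exec_jz a l' : nth IHalt code pc = IJz a l' ->
  reach t (Config (if nth 0 l a == 0 then l' else pc.+1) (regs l) m) c ->
  reach t.+1 (Config pc (regs l) m) c.
Proof. by move=> e; apply: (@reach_step t _ _ _ 1); rewrite /= e. Qed.

Lemma exec_ask a b : nth IHalt code pc = IAsk a b ->
  nth 0 l a + n <= M -> nth 0 l b + n <= M ->
  reach t (Config pc.+1 (regs l)
    (write_block m (nth 0 l b) (RO (mem_block n m (nth 0 l a))))) c ->
  reach (n + t) (Config pc (regs l) m) c.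
Proof.
move=> e le_a le_b; apply: reach_step; rewrite /= e //=.
by rewrite {1 2}/regs le_a le_b.
Qed.

End Execution.

Ltac exec_with lem := eapply lem; [reflexivity | rewrite /= ..].
Ltac exec :=
  first [ exec_with exec_const | exec_with exec_move | exec_with exec_add
        | exec_with exec_sub | exec_with exec_mul | exec_with exec_div
        | exec_with exec_load | exec_with exec_store | exec_with exec_jz
        | exec_with exec_ask ].

Definition copy_block (m : nat -> bool) (src dst i : nat) : nat -> bool :=
  fun j => if dst <= j < dst + i then m (src + (j - dst)) else m j.

Lemma copy_block0 m src dst : copy_block m src dst 0 = m.
Proof. by apply/funext => j; rewrite /copy_block ifF //; lia. Qed.

(** Disjointness ensures that the first write spares the source cells still to be read. *)
Lemma copy_blockS m src dst i :
  (src + i < dst) || (dst + i < src) ->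
  copy_block (upd m dst (m src)) src.+1 dst.+1 i = copy_block m src dst i.+1.
Proof.
move=> dis; apply/funext => j; rewrite /copy_block /upd.
have [->|neq_j] := eqVneq j dst.
  by rewrite ltnn /= ifT; [rewrite subnn addn0|lia].
have -> : (dst <= j < dst + i.+1) = (dst < j < dst.+1 + i) by lia.
case: ifP => [/andP[lt_j le_j]|//].
rewrite ifF; last by lia.
by congr m; lia.
Qed.

(** Reducing at each bit keeps the accumulator below [2 * v], within a word. *)
Lemma foldl_horner_mod (v p : nat) (s : seq bool) :
  foldl (fun p (c : bool) => (p + p + c) %% v) (p %% v) s =
  foldl (fun p (c : bool) => p + p + c) p s %% v.
Proof.
elim: s p => //= c s IHs p; rewrite -IHs; congr foldl.
by rewrite -[LHS]modnDml modnDm modnDml.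
Qed.

Section Loops.
Variables (n W M : nat) (RO : oracle n).
Local Notation reach := (reach W M RO line_code).

Lemma horner_loop r0 r1 r2 r4 r5 r6 r7 v r9 r10 i p addr tmp m :
  p < v -> 2 * v < 2 ^ W -> addr + i <= M -> M < 2 ^ W ->
  exists tmp', reach (10 * i).+1
    (Config 21 (regs [:: r0; r1; r2; 1; r4; r5; r6; r7; v; r9; r10;
                         i; p; addr; tmp; 0]) m)
    (Config 31 (regs [:: r0; r1; r2; 1; r4; r5; r6; r7; v; r9; r10; 0;
       foldl (fun p (c : bool) => (p + p + c) %% v) p [seq m j | j <- iota addr i];
       addr + i; tmp'; 0]) m).
Proof.
move=> + v2 + M2; elim: i p addr tmp => [|i IHi] p addr tmp lt_pv le_M.
  by exists tmp; exec; rewrite addn0; apply: reach_refl.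
have c_le1 : m addr <= 1 by case: (m addr).
have v_gt0 : 0 < v by lia.
have [||tmp' IH] := IHi ((p + p + m addr) %% v) addr.+1
  ((p + p + m addr) %/ v * v); [exact: ltn_pmod|lia|].
exists tmp'; have -> : (10 * i.+1).+1 = (10 * i).+1.+4.+4.+2 by lia.
have le_divM := leq_divM (p + p + m addr) v.
have le_div := leq_div (p + p + m addr) v.
(* The instructions offer no remainder; it comes from a division, a product and a subtraction. *)
have modE x : x - x %/ v * v = x %% v by rewrite {1}(divn_eq x v) addKn.
do 10!(exec; try lia).
by rewrite modE addn1 subn1 addnS -addSn.
Qed.

(** The same seven instructions occur at 35 and at 51; [(L, L')] gives entry and exit. *)
Lemma copy_loop L L' r0 r1 r2 r4 r5 r6 r7 r8 r9 r10 i src dst tmp m :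
  (L, L') \in [:: (35, 42); (51, 58)] ->
  src + i <= M -> dst + i <= M -> M < 2 ^ W ->
  (src + i <= dst) || (dst + i <= src) ->
  exists tmp', reach (7 * i).+1
    (Config L (regs [:: r0; r1; r2; 1; r4; r5; r6; r7; r8; r9; r10;
                        i; src; dst; tmp; 0]) m)
    (Config L' (regs [:: r0; r1; r2; 1; r4; r5; r6; r7; r8; r9; r10;
       0; src + i; dst + i; tmp'; 0]) (copy_block m src dst i)).
Proof.
move=> LP + + M2.
elim: i src dst tmp m => [|i IHi] src dst tmp m le_src le_dst dis.
  exists tmp; rewrite copy_block0 !addn0.
  by move: LP; rewrite !inE => /orP[] /eqP[-> ->]; exec; apply: reach_refl.
have [|||tmp' IH] := IHi src.+1 dst.+1 (m src) (upd m dst (m src)); try lia.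
exists tmp'; have -> : (7 * i.+1).+1 = (7 * i).+1.+4.+3 by lia.
have c_le1 : m src <= 1 by case: (m src).
rewrite copy_blockS in IH; last by lia.
rewrite !addnS -!addSn.
have mE (c : bool) : (nat_of_bool c != 0) = c by case: c.
by move: LP IH; rewrite !inE => /orP[] /eqP[-> ->] IH; do 7!(exec; try lia);
  rewrite mE !addn1 subn1.
Qed.

End Loops.

Section Steps.
Variables (n S W h b g v : nat) (RO : oracle n) (x : bits S).
Hypotheses (b_gt0 : 0 < b) (v_gt0 : 0 < v).
Hypotheses (le_gb_n : g * b <= n) (le_vgb_S : v * (g * b) <= S).
Hypothesis le_W : 2 * (S + n) < 2 ^ W.
Local Notation reach := (reach W (S + n) RO line_code).
Local Notation store y := (nth false (x ++ y)).

Lemma nth_store (y : bits n) j :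
  store y j = if j < S then nth false x j else nth false y (j - S).
Proof. by rewrite nth_cat size_tuple. Qed.

(** Slots are filled in increasing order, so slot [k] is still original when it is decoded. *)
Lemma read_slot (st : bits n) k : k < g ->
  foldl (fun p (c : bool) => (p + p + c) %% v) 0
    [seq store (fill b g v x k st) j | j <- iota (S + k * b) b] =
  slot_row b v (k * b) st.
Proof.
move=> lt_kg; rewrite -[0](mod0n v) foldl_horner_mod.
congr (foldl _ _ _ %% _); apply: (@eq_from_nth _ false).
  by rewrite size_map size_iota size_tuple.
move=> i; rewrite size_map size_iota => lt_i.
rewrite (nth_map 0) ?size_iota // nth_iota // nth_store nth_mem_block lt_i.
have lt_n : k * b + i < n by nia.
rewrite ifF; last by lia.
rewrite nth_fill ifF; last by nia.
have -> : S + k * b + i - S = k * b + i by lia.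
by rewrite lt_n.
Qed.

Lemma write_slot (st : bits n) k : k < g ->
  copy_block (store (fill b g v x k st))
    (slot_row b v (k * b) st * (g * b) + k * b) (S + k * b) b =
  store (fill b g v x k.+1 st).
Proof.
move=> lt_kg; apply/funext => j; rewrite /copy_block.
have lt_row := slot_row_lt b v_gt0 (k * b) st.
have le_cell := cell_le_S b_gt0 v_gt0 le_gb_n le_vgb_S st lt_kg.
case: ifP => [/andP[le_j lt_j]|nj]; rewrite !nth_store.
  rewrite ifT; last by lia.
  rewrite ifF; last by lia.
  rewrite nth_fill.
  have [lt1 lt2] : j - S < n /\ j - S < k.+1 * b by nia.
  have -> : (j - S) %/ b = k.
    apply/eqP; rewrite eqn_leq -ltnS ltn_divLR // leq_divRL //; lia.
  by rewrite lt1 lt2 /=; congr nth; lia.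
case: ltnP => // le_Sj; rewrite !nth_fill; congr (_ && _).
have -> : (j - S < k.+1 * b) = (j - S < k * b) by apply/idP/idP; lia.
by [].
Qed.

(** A slot costs [10 * b + 1] for decoding, [7 * b + 1] for copying and 11 other instructions. *)
Lemma slot_loop (st : bits n) T kc r11 r12 r13 r14 : kc <= g ->
  exists a11 a12 a13 a14, reach ((17 * b + 13) * kc).+1
    (Config 17 (regs [:: n; S; T; 1; h; b; g; g * b; v; (g - kc) * b; kc;
                         r11; r12; r13; r14; 0]) (store (fill b g v x (g - kc) st)))
    (Config 45 (regs [:: n; S; T; 1; h; b; g; g * b; v; g * b; 0;
                         a11; a12; a13; a14; 0]) (store (fill b g v x g st))).
Proof.
elim: kc r11 r12 r13 r14 => [|kc IHkc] r11 r12 r13 r14 le_kc.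
  exists r11, r12, r13, r14; rewrite subn0 muln0; exec; exact: reach_refl.
set k := g - kc.+1.
have lt_kg : k < g by lia.
have kS : g - kc = k.+1 by lia.
have lt_kb : k * b + b <= g * b by nia.
have lt_row := slot_row_lt b v_gt0 (k * b) st.
have le_cell := cell_le_S b_gt0 v_gt0 le_gb_n le_vgb_S st lt_kg.
have le_v : v <= S by nia.
have le_g : g <= g * b by rewrite leq_pmulr.
pose m := store (fill b g v x k st).
have [||||t1 H1] := @horner_loop n W (S + n) RO n S T h b g (g * b) v (k * b) kc.+1
  b 0 (S + k * b) r14 m; try lia.
rewrite read_slot // in H1.
have [|||||t2 H2] := @copy_loop n W (S + n) RO 35 42 n S T h b g (g * b) v (k * b)
  kc.+1 b (slot_row b v (k * b) st * (g * b) + k * b) (S + k * b) t1 m; try lia.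
  by [].
rewrite write_slot // in H2.
have [a11 [a12 [a13 [a14 IH]]]] := IHkc 0
  (slot_row b v (k * b) st * (g * b) + k * b + b) (S + k * b + b) t2 (ltnW le_kc).
exists a11, a12, a13, a14.
eapply reach_le; last first.
  do 4!(exec; try lia).
  eapply reach_trans; first exact: H1.
  do 4!(exec; try lia).
  eapply reach_trans; first exact: H2.
  do 3!(exec; try lia).
  by rewrite subn1 -mulSnr -kS; apply: IH.
by nia.
Qed.

Lemma ask_store (y : bits n) :
  write_block (store y) S (RO (mem_block n (store y) S)) = store (RO y).
Proof.
have -> : mem_block n (store y) S = y.
  apply: eq_bits => i lt_i; rewrite nth_mem_block lt_i nth_store ifF; last by lia.
  by rewrite addKn.
apply/funext => j; rewrite /write_block !nth_store.
case: ifP => [/andP[le_Sj lt_j]|nj]; first by rewrite ltnNge le_Sj.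
by case: ltnP => // le_Sj; rewrite !nth_bits_default //; lia.
Qed.

Lemma step_loop (st : bits n) T r9 r10 r11 r12 r13 r14 : T < 2 ^ W ->
  exists a9 a10 a11 a12 a13 a14, reach ((g * (17 * b + 13) + n + 6) * T).+1
    (Config 14 (regs [:: n; S; T; 1; h; b; g; g * b; v; r9; r10;
                         r11; r12; r13; r14; 0]) (store st))
    (Config 48 (regs [:: n; S; 0; 1; h; b; g; g * b; v; a9; a10;
                         a11; a12; a13; a14; 0])
       (store (iter T (fun st => RO (fill b g v x g st)) st))).
Proof.
elim: T st r9 r10 r11 r12 r13 r14 => [|T IHT] st r9 r10 r11 r12 r13 r14 lt_T.
  exists r9, r10, r11, r12, r13, r14.
  by rewrite muln0; exec; apply: reach_refl.
have le_g : g <= g * b by rewrite leq_pmulr.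
have [a11 [a12 [a13 [a14 H1]]]] := slot_loop st T.+1 r11 r12 r13 r14 (leqnn g).
rewrite subnn mul0n in H1.
have fill0 : fill b g v x 0 st = st.
  by apply: eq_bits => i lt_i; rewrite nth_fill lt_i.
rewrite fill0 in H1.
have [c9 [c10 [c11 [c12 [c13 [c14 IH]]]]]] :=
  IHT (RO (fill b g v x g st)) (g * b) 0 a11 a12 a13 a14 (ltnW lt_T).
exists c9, c10, c11, c12, c13, c14; rewrite iterSr.
move: (fill b g v x g st) H1 IH => y H1 IH; eapply reach_le; last first.
  do 3!(exec; try lia).
  eapply reach_trans; first exact: H1.
  exec; try lia.
  do 2!(exec; try lia).
  by rewrite subn1 ask_store; apply: IH.
by nia.
Qed.

End Steps.

(** The root is found by incrementing [h0] until [144 * h0 ^ 2] exceeds [n]. The loop thus exits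
    with [h.+1], which instruction 7 corrects. *)
Lemma root_loop n S T W M RO h d h0 r13 r14 m :
  h0 + d = h -> 144 * (h * h) <= n < 144 * (h.+1 * h.+1) ->
  144 * (h.+1 * h.+1) < 2 ^ W ->
  exists a13 a14, reach W M (RO : oracle n) line_code (6 * d.+1)
    (Config 1 (regs [:: n; S; T; 1; h0; 0; 0; 0; 0; 0; 0; 0; 0; r13; r14; 0]) m)
    (Config 7 (regs [:: n; S; T; 1; h.+1; 0; 0; 0; 0; 0; 0; 0; 0; a13; a14; 0]) m).
Proof.
move=> eh /andP[le_n lt_n] lt_W.
elim: d h0 r13 r14 eh => [|d IHd] h0 r13 r14 eh.
  rewrite addn0 in eh; rewrite eh.
  exists (h.+1 * h.+1), (144 * (h.+1 * h.+1) - n).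
  have lt_sub : 144 * (h.+1 * h.+1) - n == 0 = false by lia.
  rewrite muln1; do 6!(exec; rewrite ?addn1; try nia).
  by rewrite lt_sub; apply: reach_refl.
have [|a13 [a14 IH]] := IHd h0.+1 (h0.+1 * h0.+1) (144 * (h0.+1 * h0.+1) - n).
  by rewrite addSnnS.
exists a13, a14.
have le_sq : h0.+1 * h0.+1 <= h * h by nia.
have sub0 : 144 * (h0.+1 * h0.+1) - n == 0 by lia.
have -> : 6 * d.+2 = (6 * d.+1).+4.+2 by lia.
do 6!(exec; rewrite ?addn1; try nia).
by rewrite sub0; apply: IH.
Qed.

Lemma line_ram_run (n S T h W : nat) (RO : oracle n) (x : bits S) :
  0 < h -> 144 * (h * h) <= n < 144 * (h.+1 * h.+1) -> n <= S -> S <= T ->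
  4 * T + 144 < 2 ^ W ->
  exists (t : nat) (c : config 16),
    [/\ t <= 100 * (T * n),
        ram_run W (S + n) RO line_code t (ram_init 16 n T x) c
      & mem_block n (cfg_mem c) 0 =
        line_state (12 * h) (8 * h) (S %/ (8 * h * (12 * h))) RO x T].
Proof.
move=> h_gt0 nP le_nS le_ST lt_W; have /andP[le_n lt_n] := nP.
set b := 12 * h; set g := 8 * h; set v := S %/ (g * b).
have b_gt0 : 0 < b by lia.
have gb_E : g * b = 96 * (h * h) by lia.
have gb_gt0 : 0 < g * b by nia.
have v_gt0 : 0 < v by rewrite divn_gt0 //; lia.
have le_gb_n : g * b <= n by lia.
have le_vgb_S : v * (g * b) <= S by exact: leq_divM.
have le_hh : h <= h * h by rewrite leq_pmulr.
have lt_W' : 2 * (S + n) < 2 ^ W by lia.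
have lt_hW : 144 * (h.+1 * h.+1) < 2 ^ W by nia.
have le_vS : v <= S by apply: leq_div.
have [bE [gE vE]] : 12 * h = b /\ 8 * h = g /\ S %/ (g * b) = v by [].
have le_step : g * (17 * b + 13) + n + 6 <= 40 * n by rewrite -bE -gE; lia.
clearbody v g b.
have [a13 [a14 H1]] :=
  root_loop S T (S + n) RO 0 0 (nth false x) (add0n h) nP lt_hW.
have [c9 [c10 [c11 [c12 [c13 [c14 H2]]]]]] :=
  step_loop h RO x b_gt0 v_gt0 le_gb_n le_vgb_S lt_W' [tuple false | _ < n]
    0 0 0 0 a13 8 (leq_ltn_trans (leq_trans (leq_pmull T (isT : 0 < 4))
      (leq_addr 144 _)) lt_W).
have [y yE] : exists y, y = line_state b g v RO x T by eexists.
rewrite -/(line_state b g v RO x T) -yE in H2.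
have [|||||t2 H3] := @copy_loop n W (S + n) RO 51 58 n S 0 h b g (g * b) v c9 c10
  n S 0 c14 (nth false (x ++ y)); try lia.
  by [].
(* Cells beyond the input read as 0, so the initial zero state is already stored at address [S]. *)
have m0 : nth false x = nth false (x ++ [tuple false | _ < n]).
  apply/funext => j; rewrite nth_store; case: ltnP => // le_Sj.
  rewrite nth_bits_default // (nth_mktuple_bits n (fun=> false)) andbF.
  by [].
rewrite -m0 in H2.
have run : reach W (S + n) RO line_code
    (15 + 6 * h.+1 + ((g * (17 * b + 13) + n + 6) * T).+1 + (7 * n).+1)
    (ram_init 16 n T x)
    (Config 58 (regs [:: n; S; 0; 1; h; b; g; g * b; v; c9; c10; 0; S + n; 0 + n; t2; 0])
       (copy_block (nth false (x ++ y)) S 0 n)).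
  eapply reach_le; last first.
    have -> : ram_init 16 n T x =
        Config 0 (regs [:: n; S; T; 0; 0; 0; 0; 0; 0; 0; 0; 0; 0; 0; 0; 0])
          (nth false x).
      congr Config; apply/funext => -[i lt_i]; rewrite /regs /=.
      by do 3!case: i lt_i => //= i lt_i; do 13!case: i lt_i => //= i lt_i.
    exec; try lia.
    eapply reach_trans; first exact: H1.
    do 7!(exec; rewrite ?subSS ?subn0 ?bE ?gE ?vE; try lia).
    eapply reach_trans; first exact: H2.
    do 3!(exec; try lia).
    exact: H3.
  by lia.
have halt : ram_run W (S + n) RO line_code 1
    (Config 58 (regs [:: n; S; 0; 1; h; b; g; g * b; v; c9; c10; 0; S + n; 0 + n; t2; 0])
       (copy_block (nth false (x ++ y)) S 0 n))
    (Config 58 (regs [:: n; S; 0; 1; h; b; g; g * b; v; c9; c10; 0; S + n; 0 + n; t2; 0])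
       (copy_block (nth false (x ++ y)) S 0 n)) by apply: RunHalt.
have [t le_t run'] := run _ _ halt.
exists t; eexists; split; [|exact: run'|].
  apply: leq_trans le_t _.
  have le_steps := leq_mul le_step (leqnn T).
  have le_nT : n <= T * n by rewrite leq_pmull //; lia.
  by lia.
rewrite -yE; apply: eq_bits => i lt_i; rewrite nth_mem_block lt_i /= /copy_block.
rewrite add0n lt_i subn0 nth_store ifF ?addKn //; lia.
Qed.

Lemma root_bounds (n : nat) :
  exists h, 144 * (h * h) <= n < 144 * (h.+1 * h.+1).
Proof.
elim: n => [|n [h /andP[le_n lt_n]]]; first by exists 0.
have [lt_Sn|le_Sn] := ltnP n.+1 (144 * (h.+1 * h.+1)).
  by exists h; rewrite lt_Sn leqW.
by exists h.+1; rewrite le_Sn /=; lia.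
Qed.

Lemma line_ram_computes (n S T h : nat) :
  40 <= h -> 144 * (h * h) <= n < 144 * (h.+1 * h.+1) -> n <= S -> S <= T ->
  T <= 2 ^ (h %/ 4) ->
  ram_computes (RamProg line_code) T (100 * (trunc_log 2 T).+1) (100 * S)
    (100 * (T * n))
    (fun (RO : oracle n) (x : bits S) =>
       line_state (12 * h) (8 * h) (S %/ (8 * h * (12 * h))) RO x T).
Proof.
move=> h_ge nP le_nS le_ST le_T; have /andP[le_n _] := nP.
have T_gt0 : 0 < T by nia.
have le_log : trunc_log 2 T <= h %/ 4.
  have lt_log := trunc_logP (isT : 1 < 2) T_gt0.
  by rewrite -(@leq_exp2l 2) // (leq_trans lt_log).
(* Memory takes at most [2 * S] bits; the 16 registers fit in the rest because [log T <= h / 4]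
   while [S >= 144 * h ^ 2]. *)
exists (S + n); first by rewrite /=; nia.
move=> RO x; apply: line_ram_run => //; first by lia.
have lt_T := trunc_log_ltn T (isT : 1 < 2).
set w := (trunc_log 2 T).+1 in lt_T *.
apply: (@leq_trans (2 ^ (10 + w))); last by rewrite leq_exp2l //; lia.
by rewrite expnD; set E := 2 ^ w in lt_T *; rewrite -[2 ^ 10]/(1000 + 24); lia.
Qed.

(** * Asymptotic estimates and the final assembly *)

Local Open Scope ring_scope.
Import Order.TTheory GRing.Theory Num.Theory.

(** With [y = n ^ (1 / 4)], [y ^ 2 < 12 * (h + 1)], so [h %/ 4] is at least about [y ^ 2 / 48] and
    eventually exceeds [K * y]. The [+ 1] in [Y] absorbs the rounding. *)
Lemma exp_quarter_le (R : realType) (K : R) :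
  exists n0 : nat, forall n h : nat, (n0 <= n)%N ->
    (n < 144 * (h.+1 * h.+1))%N ->
    (40 <= h)%N /\ exp_quarter K n <= (2 ^ (h %/ 4))%N%:R.
Proof.
pose Y := 48 * (`|K| + 1).
have K_ge0 : 0 <= `|K| by rewrite normr_ge0.
have Y_ge : 48 <= Y by rewrite /Y; lra.
exists (Num.bound (Y ^+ 4)) => n h le_n lt_n.
pose y : R := n%:R `^ (1 / 4).
have y_ge0 : 0 <= y by rewrite powR_ge0.
have y4 : y ^+ 4 = n%:R.
  rewrite -powR_mulrn // -powRrM.
  have -> : 1 / 4 * 4%:R = 1 :> R by lra.
  by rewrite powRr1.
have le_Yy : Y <= y.
  rewrite -(@ler_pXn2r _ 4) ?nnegrE //; last by lra.
  rewrite y4; apply: le_trans (ltW (archi_boundP _)) _; last by rewrite ler_nat.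
  by apply: exprn_ge0; lra.
have lt_y2 : y ^+ 2 < 12 * (h%:R + 1).
  have h_ge0 : 0 <= h%:R :> R by rewrite ler0n.
  rewrite -(@ltr_pXn2r _ 2) ?nnegrE ?exprn_ge0 //; last by lra.
  rewrite -exprM y4.
  have : n%:R < (144 * (h.+1 * h.+1))%N%:R :> R by rewrite ltr_nat.
  by rewrite !natrM -!natr1 exprMn; lra.
have lt_h : h%:R + 1 <= 4 * (h %/ 4)%:R + 4 :> R.
  have : (h.+1 <= 4 * (h %/ 4) + 4)%N by lia.
  by rewrite -(ler_nat R) natrD natrM -natr1.
split.
  rewrite -(ler_nat R).
  have : 48 * 48 <= y ^+ 2 by rewrite expr2; nra.
  by lra.
rewrite /exp_quarter -/y natrX -powR_mulrn //.
apply: ler_powR; first by lra.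
have le_Ky : K * y <= `|K| * y by rewrite ler_wpM2r // ler_norm.
have : Y * y <= y ^+ 2 by rewrite expr2 ler_wpM2r.
rewrite /Y mulrDr mulrDl mulr1 -mulrA.
by lra.
Qed.

Theorem theorem3p1 (R : realType) :
  exists c : R, 1 < c /\
  forall K : R,
  exists (P : ram_prog) (A d n0 : nat) (delta : R), 0 < delta /\
  forall n : nat, (0 < n)%N -> (n0 <= n)%N ->
  forall S T : nat,
    (n <= S)%N -> S%:R < exp_quarter K n ->
    (S <= T)%N -> T%:R < exp_quarter K n ->
  exists f : oracle n -> bits S -> bits n,
    ram_computes P T (A * (trunc_log 2 T).+1) (A * S) (A * (T * n)) f /\
    forall (m s q tl rd : nat) (p : 'I_S -> 'I_m) (M : mpc n m tl),
      m%:R < exp_quarter K n ->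
      s%:R <= S%:R / c ->
      q%:R < 2 `^ (n%:R / 4) :> R ->
      mpc_within M p rd s q ->
      computes_on_average R M p rd f ->
      delta * (T%:R / ln T%:R ^+ d) <= rd%:R.
Proof.
exists (2 ^+ 17); split; first by rewrite exprn_egt1 // ltr1n.
move=> K; have [n0 n0P] := exp_quarter_le K.
(* With [d = 0] no logarithmic factor is lost; [delta = 1 / 2] absorbs the off-by-one in
   [T <= rd.+1]. *)
exists (RamProg line_code), 100, 0, n0, (1 / 2); split; first by lra.
move=> n _ le_n0 S T le_nS lt_S le_ST lt_T.
have [h nP] := root_bounds n; have /andP[le_hn lt_hn] := nP.
have [h_ge le_exp] := n0P _ _ le_n0 lt_hn.
have natP k : k%:R < exp_quarter K n -> (k <= 2 ^ (h %/ 4))%N.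
  by move=> lt_k; rewrite -(ler_nat R) (le_trans (ltW lt_k)).
exists (fun RO x =>
  line_state (12 * h) (8 * h) (S %/ (8 * h * (12 * h))) RO x T); split.
  exact: line_ram_computes (natP _ lt_T).
move=> m s q tl rd p M lt_m le_s lt_q withinM.
rewrite expr0 divr1.
have [le_T|lt_rdT] := leqP T rd.+1.
  have : (T <= 2 * rd)%N by nia.
  by rewrite -(ler_nat R) natrM; lra.
have le_s' : (s * 2 ^ 17 <= S)%N.
  by rewrite -(ler_nat R) natrM natrX -ler_pdivlMr // exprn_gt0.
(* The exponent is a quarter of the upper bound [144 * (h + 1) ^ 2] on [n]. *)
have le_q : (q <= 2 ^ (36 * (h.+1 * h.+1)))%N.
  rewrite -(ler_nat R) natrX -powR_mulrn // (le_trans (ltW lt_q)) //.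
  apply: ler_powR; first by lra.
  have : (n <= 4 * (36 * (h.+1 * h.+1)))%N by lia.
  by rewrite -(ler_nat R) natrM; lra.
have le_S : (S <= 2 ^ h)%N.
  by apply: leq_trans (natP _ lt_S) _; rewrite leq_exp2l //; lia.
pose f (RO : oracle n) (x : bits S) :=
  line_state (12 * h) (8 * h) (S %/ (8 * h * (12 * h))) RO x T.
have bound := @card_success_tape n S m tl rd M p f 4 (fun z =>
  card_line_success h_ge le_hn le_nS le_S le_q le_s' z (natP _ lt_T) (natP _ lt_m)
    withinM lt_rdT).
rewrite -/f /computes_on_average /mpc_success.
set A := #|_| in bound *; set W := #|_| in bound *.
have W_gt0 : (0 < W)%N.
  apply/card_gt0P; exists ([ffun=> [tuple false | _ < n]],
    [tuple false | _ < tl], [tuple false | _ < S]) => //.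
rewrite ler_pdivlMr ?ltr0n //.
(* The success probability is at most 1/4, below the required 1/3. *)
have : A%:R * 4 <= W%:R :> R by rewrite -natrM ler_nat.
have : 0 < W%:R :> R by rewrite ltr0n.
by lra.
Qed.
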